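(* Let $\lambda_0,\dots,\lambda_{N-1}$ be nonnegative constants with $0<\sum_{i=0}^{N-1}\lambda_i\le\Lambda$, where $\Lambda$ is a positive constant independent of $n$. Suppose that the nonnegative sequences $\{\xi^n\}_{n\ge1}$ and $\{\zeta^n\}_{n\ge1}$ are bounded and that the nonnegative grid function $\{v^n : n\ge 0\}$ satisfies $$D_N (v^{n-\sigma_n})^2 \le \sum_{k=1}^{n}\lambda_{n-k}\,(v^{k,\sigma_k})^2+\xi^n\,v^{n,\sigma_n}+(\zeta^n)^2,\qquad 1\le n\le N.$$ If the grid satisfies $\max_{1\le n\le N}\tau_n\le\left(\frac{11}{2\mu}\Lambda\right)^{-1/\alpha_1}$, then for $1\le n\le N$ $$v^n\le 2E_{\alpha_1}\!\left(\frac{11}{2\mu_1}\,\Lambda\,t_n^{\alpha_1}\right)\left[v^0+\max_{1\le k\le n}\sum_{j=1}^{k}p_{k,j}(\xi^j+\zeta^j)+\max_{1\le j\le n}\zeta^j\right].$$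
   Context: Parameters: $T>0$, $m,N\in\mathbb{N}$, $\mu_s>0$ for $s=1,\dots,m$, $0<\alpha_m<\dots<\alpha_1<1$, and $\mu:=\min_{1\le s\le m}\frac{\mu_s}{\Gamma(2-\alpha_s)}$. Graded mesh: $t_n=T(n/N)^r$, $n=0,\dots,N$, with grading parameter $r\ge1$; $\tau_n=t_n-t_{n-1}$; $t_{j-1/2}=\frac12(t_{j-1}+t_j)$. Shift parameters: for $n=1,\dots,N$ let $\sigma_n^\star$ be the unique root in $[1-\frac{\alpha_1}{2},1-\frac{\alpha_m}{2}]$ of $\mathcal{G}_n(\sigma)=\sum_{s=1}^m\frac{\mu_s}{\Gamma(3-\alpha_s)}\sigma^{1-\alpha_s}\big[\sigma-(1-\frac{\alpha_s}{2})\big]\tau_n^{2-\alpha_s}$, and put $\sigma_n=1-\sigma_n^\star$, $t_{n-\sigma_n}=(1-\sigma_n)t_n+\sigma_nt_{n-1}$, $v^{n,\sigma_n}=(1-\sigma_n)v^n+\sigma_nv^{n-1}$. Coefficients: $a^{(\alpha_s,\sigma_n)}_{n,n}=\frac{1}{\Gamma(1-\alpha_s)}\int_{t_{n-1}}^{t_{n-\sigma_n}}(t_{n-\sigma_n}-\eta)^{-\alpha_s}d\eta$ and, for $1\le j\le n-1$, $a^{(\alpha_s,\sigma_n)}_{n,j}=\frac{1}{\Gamma(1-\alpha_s)}\int_{t_{j-1}}^{t_j}(t_{n-\sigma_n}-\eta)^{-\alpha_s}d\eta$, $b^{(\alpha_s,\sigma_n)}_{n,j}=\frac{2}{\Gamma(1-\alpha_s)(t_{j+1}-t_{j-1})}\int_{t_{j-1}}^{t_j}(t_{n-\sigma_n}-\eta)^{-\alpha_s}(\eta-t_{j-1/2})d\eta$.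 Then $g^{(\alpha_s,\sigma_1)}_{1,1}=\tau_1^{-1}a^{(\alpha_s,\sigma_1)}_{1,1}$ and, for $n\ge2$, $g^{(\alpha_s,\sigma_n)}_{n,1}=\tau_1^{-1}(a^{(\alpha_s,\sigma_n)}_{n,1}-b^{(\alpha_s,\sigma_n)}_{n,1})$; $g^{(\alpha_s,\sigma_n)}_{n,j}=\tau_j^{-1}(a^{(\alpha_s,\sigma_n)}_{n,j}+b^{(\alpha_s,\sigma_n)}_{n,j-1}-b^{(\alpha_s,\sigma_n)}_{n,j})$ for $2\le j\le n-1$; $g^{(\alpha_s,\sigma_n)}_{n,n}=\tau_n^{-1}(a^{(\alpha_s,\sigma_n)}_{n,n}+b^{(\alpha_s,\sigma_n)}_{n,n-1})$. Set $g_{n,j}=\sum_{s=1}^m\mu_s\,g^{(\alpha_s,\sigma_n)}_{n,j}$ for $1\le j\le n\le N$. Discrete derivative: $D_Nv^{n-\sigma_n}:=\sum_{j=1}^ng_{n,j}(v^j-v^{j-1})$; in particular $D_N(v^{n-\sigma_n})^2:=\sum_{j=1}^ng_{n,j}\big((v^j)^2-(v^{j-1})^2\big)$. Complementary coefficients: $p_{n,i}$, $1\le i\le n\le N$, are defined by $p_{n,n}=\frac1{g_{n,n}}$ and $p_{n,i}=\frac{1}{g_{i,i}}\sum_{k=i+1}^n(g_{k,i+1}-g_{k,i})p_{n,k}$ for $1\le i\le n-1$; equivalently $\sum_{k=j}^np_{n,k}g_{k,j}=1$ for $1\le j\le n\le N$. Mittag-Leffler function: $E_{\alpha_1}(z)=\sum_{k=0}^\infty\frac{z^k}{\Gamma(1+k\alpha_1)}$.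 *)

(* Defs.v *)
From HB Require Import structures.
From mathcomp Require Import all_boot all_order all_algebra.
From mathcomp Require Import all_classical all_reals all_analysis.
Set Implicit Arguments.
Unset Strict Implicit.
Unset Printing Implicit Defensive.
Import Order.TTheory GRing.Theory Num.Theory.
Import numFieldNormedType.Exports.
Local Open Scope classical_set_scope.
Local Open Scope ring_scope.

(* Sequences are functions [nat -> R] carrying the indices of the mathematical
   text: orders [alpha s] and weights [mu s] for 1 <= s <= m, nodes [t n] for
   0 <= n <= N, steps and shifts for 1 <= n <= N. Values at other indices are
   never used. *)

(* Meaningful for 0 < x, the only case that occurs below. *)
Definition Gamma (R : realType) (x : R) : R :=
  \int[@lebesgue_measure R]_(u in `]0, +oo[) (u `^ (x - 1) * expR (- u)).

Definition mittag_leffler (R : realType) (a z : R) : R :=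
  limn (series (fun k : nat => z ^+ k / Gamma (1 + k%:R * a))).

(* Maximum and minimum of F 1, ..., F n, for 1 <= n. The neutral element of the
   iterated operation is F 1, so that no sign condition on F is involved. *)
Definition max1 (R : realType) (n : nat) (F : nat -> R) : R :=
  \big[Num.max/F 1%N]_(1 <= k < n.+1) F k.

Definition min1 (R : realType) (n : nat) (F : nat -> R) : R :=
  \big[Num.min/F 1%N]_(1 <= k < n.+1) F k.

Definition graded_mesh (R : realType) (T r : R) (N n : nat) : R :=
  T * (n%:R / N%:R) `^ r.

Definition step (R : realType) (t : nat -> R) (n : nat) : R := t n - t n.-1.

Definition shift_fun (R : realType) (m : nat) (alpha mu t : nat -> R)
    (n : nat) (sigma : R) : R :=
  \sum_(1 <= s < m.+1)
    mu s / Gamma (3 - alpha s) * sigma `^ (1 - alpha s)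
      * (sigma - (1 - alpha s / 2)) * step t n `^ (2 - alpha s).

(* v^{n,sigma_n}; applied to the nodes themselves it gives t_{n-sigma_n}. *)
Definition shifted (R : realType) (sigma v : nat -> R) (n : nat) : R :=
  (1 - sigma n) * v n + sigma n * v n.-1.

Definition coef_a (R : realType) (t sigma : nat -> R) (al : R) (n j : nat) : R :=
  let tn := shifted sigma t n in
  (Gamma (1 - al))^-1 *
  \int[@lebesgue_measure R]_(eta in `[t j.-1, if j == n then tn else t j])
    (tn - eta) `^ (- al).

Definition coef_b (R : realType) (t sigma : nat -> R) (al : R) (n j : nat) : R :=
  let tn := shifted sigma t n in
  2 / (Gamma (1 - al) * (t j.+1 - t j.-1)) *
  \int[@lebesgue_measure R]_(eta in `[t j.-1, t j])
    ((tn - eta) `^ (- al) * (eta - (t j.-1 + t j) / 2)).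

(* The coefficient of v^j - v^{j-1} for a single order. The b-terms present are
   b_{n,j-1} when 2 <= j and - b_{n,j} when j <= n - 1; this covers the four
   cases n = j = 1, j = 1 < n, 1 < j < n and 1 < j = n. *)
Definition coef_g1 (R : realType) (t sigma : nat -> R) (al : R) (n j : nat) : R :=
  (step t j)^-1 *
  (coef_a t sigma al n j
   + (if (1 < j)%N then coef_b t sigma al n j.-1 else 0)
   - (if (j < n)%N then coef_b t sigma al n j else 0)).

Definition coef_g (R : realType) (m : nat) (alpha mu t sigma : nat -> R)
    (n j : nat) : R :=
  \sum_(1 <= s < m.+1) mu s * coef_g1 t sigma (alpha s) n j.

Definition discrete_deriv (R : realType) (g : nat -> nat -> R) (v : nat -> R)
    (n : nat) : R :=
  \sum_(1 <= j < n.+1) g n j * (v j - v j.-1).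

(* p_{n,i} is obtained by recursion on n - i; [d] is fuel and any value
   d >= n - i gives the same result. The recursion equations are proved below. *)
Fixpoint compl_rec (R : realType) (g : nat -> nat -> R) (n d i : nat) : R :=
  if i == n then (g n n)^-1 else
  if d is d'.+1 then
    (g i i)^-1 *
    \sum_(i.+1 <= k < n.+1) (g k i.+1 - g k i) * compl_rec g n d' k
  else 0.

Definition compl (R : realType) (g : nat -> nat -> R) (n i : nat) : R :=
  compl_rec g n (n - i) i.

Lemma compl_rec_fuel (R : realType) (g : nat -> nat -> R) (n d i : nat) :
  (n - i <= d)%N -> (i <= n)%N -> compl_rec g n d i = compl g n i.
Proof.
elim: d {-2}d (leqnn d) i => [|e IH] d hde i hd hi.
  by move: hd; rewrite /compl; move: hde; rewrite leqn0 => /eqP ->;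
    rewrite leqn0 => /eqP ->.
rewrite /compl; case: (eqVneq i n) => [->|ne_in].
  by rewrite subnn; case: d {hde hd} => [|d] /=; rewrite eqxx.
have lt_in : (i < n)%N by rewrite ltn_neqAle ne_in.
case: d hde hd => [|d] hde hd; first by rewrite leqn0 subn_eq0 leqNgt lt_in in hd.
case E : (n - i)%N => [|q]; first by move/eqP: E; rewrite subn_eq0 leqNgt lt_in.
rewrite /= (negbTE ne_in); congr (_ * _).
apply: eq_big_nat => k /andP[ik kn]; congr (_ * _).
have hk : (n - k <= q)%N.
  by rewrite -ltnS -E; apply: ltn_sub2l.
have qd : (q <= d)%N by rewrite -ltnS -E.
have kn' : (k <= n)%N by [].
by rewrite (IH d hde k (leq_trans hk qd) kn') (IH q (leq_trans qd hde) k hk kn').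
Qed.

Lemma compl_nn (R : realType) (g : nat -> nat -> R) (n : nat) :
  compl g n n = (g n n)^-1.
Proof. by rewrite /compl subnn /= eqxx. Qed.

Lemma compl_lt (R : realType) (g : nat -> nat -> R) (n i : nat) : (i < n)%N ->
  compl g n i =
  (g i i)^-1 * \sum_(i.+1 <= k < n.+1) (g k i.+1 - g k i) * compl g n k.
Proof.
move=> lt_in; rewrite {1}/compl -(subnSK lt_in) /= (ltn_eqF lt_in).
congr (_ * _); apply: eq_big_nat => k /andP[ik kn]; congr (_ * _).
by apply: compl_rec_fuel => //; apply: leq_sub2l.
Qed.

(* Main.v *)
Require Import Defs.
From HB Require Import structures.
From mathcomp Require Import all_boot all_order all_algebra.
From mathcomp Require Import all_classical all_reals all_analysis.
From mathcomp Require Import measurable_realfun.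
From mathcomp Require Import ring lra.
Import Order.TTheory GRing.Theory Num.Theory.
Import numFieldNormedType.Exports.
Set Implicit Arguments.
Unset Strict Implicit.
Unset Printing Implicit Defensive.
Local Open Scope classical_set_scope.
Local Open Scope ring_scope.

(** The complementary coefficients invert the discrete derivative: from
[\sum_(j <= k <= n) p n k * g k j = 1], summing the hypothesis at the indices
k <= n against [p n k] turns the left-hand side into [v n ^ 2 - v 0 ^ 2]. At an
index n where v is larger than before and larger than the zeta's one may divide
by [v n]. The step restriction gives [2 * Lambda <= g n n], so that the term
k = n, at most [Lambda * v n / g n n], is absorbed in the left-hand side, and
what remains is
[v n <= 2 * Psi n * (1 + Lambda * \sum_(j < n) p n j * F j)] where [Psi n] is
the bracket of the theorem and [F j] is the factor already obtained at j. The
induction therefore closes for every nondecreasing F >= 2 such that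
[2 * Lambda * \sum_(j < n) p n j * F j <= F n - 2] ([discrete_gronwall]).

The Mittag-Leffler factor has this property term by term. Put
omega_b(t) = t^(b-1) / Gamma(b), alpha = alpha_1 and mu = mu_1. Then
[kernel_sum] bounds the sum over j < n of p_(n,j) omega_(1+A-alpha)(t_j) by
(2 / mu) omega_(1+A)(t_n), and A = (k + 1) alpha takes the k-th term of the
series to the next one. To see this, write
omega_(1+A-alpha)(t_j) as the convolution of omega_A and omega_(1-alpha)
([integral_conv], which is Euler's Beta integral) and cut it at the nodes. On
one mesh interval the integral of the product is at most an increment of
omega_(1+A), the primitive of omega_A, times the mean of omega_(1-alpha): by
Chebyshev's inequality if omega_A decreases; if omega_A increases, by taking its
value at the right end, which the next increment dominates because the steps do
not decrease. That mean is at most [2 / mu * g j i] ([coef_g_kernel]), so the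
double sum against p collapses to a telescoping sum of increments.

What is needed about g is its positivity and its monotonicity in j, which make p
nonnegative, besides the lower bound just mentioned. For a single order let
w(s) = (t_(n-sigma_n) - s)^(-alpha). Because w is increasing and convex and the
steps do not decrease, Gamma(1-alpha) times the j-th coefficient, j < n, lies
between w(t_(j-1)) and w(t_j) ([coef_g1_ge_left], [coef_g1_le_right]), which
settles everything up to the index n - 1 order by order. Only
g_(n,n-1) <= g_(n,n) mixes the orders, and there the equation that defines the
shift is what is used ([diag_balance]). *)

(** * Affine changes of variables in Lebesgue integrals *)

Section affine.
Context {R : realType}.
Notation mu := (@lebesgue_measure R).

Definition affmap (a b x : R) : R := a * x + b.

Lemma measurable_affmap (a b : R) : measurable_fun [set: R] (affmap a b).
Proof.
apply: continuous_measurable_fun => x.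
by apply: cvgD; [apply: cvgM; [exact: cvg_cst|exact: cvg_id]|exact: cvg_cst].
Qed.

(** Both sides are measures that agree on half-open intervals; the factor
is an absolute value because a negative slope reverses the interval. *)
Lemma lebesgue_measure_affmap (a b : R) (A : set R) : a != 0 -> measurable A ->
  mu A = (`|a|%:E * mu (affmap a b @^-1` A))%E.
Proof.
move=> a0 mA.
have mf : measurable_fun [set: measurableTypeR R]
    (affmap a b : measurableTypeR R -> measurableTypeR R).
  exact: measurable_affmap.
have := @lebesgue_measure_unique R (mscale (NngNum (normr_ge0 a))
  (pushforward mu (affmap a b : measurableTypeR R -> measurableTypeR R))).
move=> /(_ mf) -> //.
move=> X [[x y] _ <-] /=.
rewrite /mscale/= /pushforward/=.
have [xy|yx] := ltP x y; last first.
  by rewrite set_itv_ge ?bnd_simp -?leNgt// preimage_set0 !measure0 mule0.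
move: a0; rewrite neq_lt => /orP[a0|a0].
  rewrite (_ : _ @^-1` _ = `[(y - b) / a, (x - b) / a[%classic); last first.
    apply/seteqP; split => z /=; rewrite /affmap !in_itv/= ler_ndivrMr// ltr_ndivlMr//
      [z * a]mulrC => /andP[h1 h2]; apply/andP; split; lra.
  have h : (y - b) / a < (x - b) / a by rewrite ltr_nM2r ?invr_lt0//; lra.
  rewrite !lebesgue_measure_itv/= !lte_fin xy h -!EFinD -EFinM ltr0_norm//.
  by congr EFin; field; rewrite lt_eqF.
rewrite (_ : _ @^-1` _ = `](x - b) / a, (y - b) / a]%classic); last first.
  apply/seteqP; split => z /=; rewrite /affmap !in_itv/= ler_pdivlMr// ltr_pdivrMr//
   
      [z * a]mulrC => /andP[h1 h2]; apply/andP; split; lra.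
have h : (x - b) / a < (y - b) / a by rewrite ltr_pM2r ?invr_gt0//; lra.
rewrite !lebesgue_measure_itv/= !lte_fin xy h -!EFinD -EFinM gtr0_norm//.
by congr EFin; field; rewrite gt_eqF.
Qed.

Lemma ge0_integral_affmap (a b : R) (f : R -> \bar R) : a != 0 ->
  measurable_fun setT f -> (forall x, (0 <= f x)%E) ->
  (\int[mu]_x f x = `|a|%:E * \int[mu]_x f (a * x + b)%R)%E.
Proof.
move=> a0 mf f0.
have mg : measurable_fun [set: measurableTypeR R]
    (affmap a b : measurableTypeR R -> measurableTypeR R).
  exact: measurable_affmap.
have H := @ge0_integral_pushforward _ _ _ _ _ _ mg mu setT f measurableT mf (fun x _ => f0 x).
rewrite preimage_setT in H.
pose nu : {measure set (measurableTypeR R) -> \bar R} :=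
  measure_function_pushforward__canonical__measure_function_Measure mu mg.
have K := @ge0_integral_mscale _ (measurableTypeR R) R nu setT measurableT
  (NngNum (normr_ge0 a)) f mf (fun x _ => f0 x).
have -> : (\int[mu]_x f (a * x + b)%R)%E = (\int[nu]_x f x)%E by exact/esym/H.
transitivity (\int[mscale (NngNum (normr_ge0 a)) nu]_x f x)%E; last exact: K.
apply: (eq_measure_integral (mscale (NngNum (normr_ge0 a)) nu)) => A mA _.
exact: lebesgue_measure_affmap.
Qed.

End affine.

(** * Real powers *)

Section powers.
Context {R : realType}.

Lemma powRDgt0 (x r s : R) : 0 < x -> x `^ (r + s) = x `^ r * x `^ s.
Proof. by move=> x0; rewrite powRD// (gt_eqF x0) implybT. Qed.

Lemma powR_continuous (a x : R) : 0 < x -> {for x, continuous (fun y : R => y `^ a)}.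
Proof.
move=> x0; apply: differentiable_continuous; apply/derivable1_diffP.
exact: (@ex_derive _ _ _ _ _ _ _ (is_derive1_powR a x0)).
Qed.

Lemma powR_MVT (A u v : R) : 0 < u -> u <= v ->
  exists2 z, u <= z <= v & v `^ A - u `^ A = A * z `^ (A - 1) * (v - u).
Proof.
move=> u0; rewrite le_eqVlt => /predU1P[<-|uv].
  by exists u; rewrite ?lexx// !subrr mulr0.
have dF (z : R) : z \in `]u, v[ ->
    is_derive z 1 (fun z => z `^ A) (A * z `^ (A - 1)).
  by rewrite in_itv/= => /andP[xz _]; apply: is_derive1_powR; lra.
have [|z] := MVT uv dF.
  apply: continuous_in_subspaceT => z; rewrite inE/= in_itv/= => /andP[xz _].
  by apply: powR_continuous; lra.
rewrite in_itv/= => /andP[/ltW uz /ltW zv] E.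
by exists z; rewrite ?uz.
Qed.

Lemma powR_chord_ge (A x y d : R) : 1 <= A -> 0 < x -> x < y -> d <= y - x ->
  A * (x `^ (A - 1) * d) <= y `^ A - x `^ A.
Proof.
move=> A1 x0 xy dxy; have [z /andP[xz zy] ->] := powR_MVT A x0 (ltW xy).
rewrite -mulrA ler_wpM2l//; first by lra.
have h : x `^ (A - 1) <= z `^ (A - 1) by rewrite ge0_ler_powR ?nnegrE//; lra.
apply: (@le_trans _ _ (x `^ (A - 1) * (y - x))).
  by rewrite ler_wpM2l// powR_ge0.
by rewrite ler_wpM2r//; lra.
Qed.

Lemma powR_chord_le (A x y : R) : 1 <= A -> 0 < x -> x < y ->
  y `^ A - x `^ A <= A * y `^ (A - 1) * (y - x).
Proof.
move=> A1 x0 xy; have [z /andP[xz zy] ->] := powR_MVT A x0 (ltW xy).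
rewrite -!mulrA ler_wpM2l//; first by lra.
rewrite ler_wpM2r//; first by lra.
by rewrite ge0_ler_powR ?nnegrE//; lra.
Qed.

Lemma powRN_nonincr (al u v : R) : 0 <= al -> 0 < u -> u <= v -> v `^ (- al) <= u `^ (- al).
Proof.
move=> al0 u0 uv; have v0 := lt_le_trans u0 uv.
rewrite !powRN lef_pV2 ?posrE ?powR_gt0// ge0_ler_powR ?nnegrE// ltW//.
Qed.

Lemma powRN_MVT (al u v : R) : 0 < u -> u <= v ->
  exists2 z, u <= z <= v & u `^ (- al) - v `^ (- al) = al * z `^ (- al - 1) * (v - u).
Proof.
move=> u0 uv; have [z uzv E] := powR_MVT (- al) u0 uv; exists z => //.
by rewrite -[LHS]opprB E; ring.
Qed.

Lemma powRN_slope_le (al p u v : R) : 0 < al -> 0 < p -> p <= u -> u <= v ->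
  u `^ (- al) - v `^ (- al) <= al * p `^ (- al - 1) * (v - u).
Proof.
move=> al0 p0 pu uv; have [z /andP[uz zv] ->] := powRN_MVT al (lt_le_trans p0 pu) uv.
rewrite ler_wpM2r ?subr_ge0// ler_wpM2l ?(ltW al0)// -opprD.
by apply: powRN_nonincr => //; lra.
Qed.

Lemma powRN_slope_ge (al p u v : R) : 0 < al -> 0 < u -> u <= v -> v <= p ->
  al * p `^ (- al - 1) * (v - u) <= u `^ (- al) - v `^ (- al).
Proof.
move=> al0 u0 uv vp; have [z /andP[uz zv] ->] := powRN_MVT al u0 uv.
rewrite ler_wpM2r ?subr_ge0// ler_wpM2l ?(ltW al0)// -opprD.
by apply: powRN_nonincr => //; lra.
Qed.

End powers.

(** * The Beta-Gamma identity *)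

Section beta_gamma.
Context {R : realType}.
Notation mu := (@lebesgue_measure R).

(** Extending the power by zero lets convolutions be integrals over the whole
line, so that Tonelli and translations need no bookkeeping of domains. *)
Definition pker (a x : R) : R := if 0 < x then x `^ (a - 1) else 0.

Lemma pker_ge0 a x : 0 <= pker a x.
Proof. by rewrite /pker; case: ifP => // _; exact: powR_ge0. Qed.

Lemma pker_gt0E a x : 0 < x -> pker a x = x `^ (a - 1).
Proof. by rewrite /pker => ->. Qed.

Lemma pker_le0E a x : x <= 0 -> pker a x = 0.
Proof. by rewrite /pker leNgt => /negbTE ->. Qed.

Lemma measurable_pker a : measurable_fun [set: R] (pker a).
Proof.
by apply: measurable_fun_ifT => //; exact: measurable_fun_ltr.
Qed.

Lemma pkerM a (z x : R) : 0 < z -> pker a (z * x) = z `^ (a - 1) * pker a x.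
Proof.
move=> z0; rewrite /pker pmulr_rgt0//; case: ifPn => x0; last by rewrite mulr0.
by rewrite powRM// ltW.
Qed.

(** The Euler integrals are kept extended-valued until their finiteness is known,
since the identity between them is what proves the finiteness. *)
Definition GammaE (a : R) : \bar R := (\int[mu]_x (pker a x * expR (- x))%:E)%E.

Definition BetaE (a b : R) : \bar R := (\int[mu]_x (pker a x * pker b (1 - x))%:E)%E.

Lemma GammaE_ge0 a : (0 <= GammaE a)%E.
Proof. by apply: integral_ge0 => x _; rewrite lee_fin mulr_ge0 ?pker_ge0 ?expR_ge0. Qed.

Lemma BetaE_ge0 a b : (0 <= BetaE a b)%E.
Proof. by apply: integral_ge0 => x _; rewrite lee_fin mulr_ge0 ?pker_ge0. Qed.

Lemma fine_GammaE (a : R) : Gamma a = fine (GammaE a).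
Proof.
rewrite /Gamma /Rintegral integral_mkcond; congr fine; apply: eq_integral => x _.
rewrite patchE /pker; case: ifPn => [|]; rewrite ?inE/= ?in_itv/= ?andbT.
  by move=> ->.
by rewrite notin_setE/= in_itv/= andbT => /negP/negbTE ->; rewrite mul0r.
Qed.

Lemma measurable_expRN : measurable_fun [set: R] (fun x : R => expR (- x)).
Proof. by apply: measurableT_comp => //; exact: measurable_funN. Qed.

Lemma measurable_pkerB b (z : R) : measurable_fun [set: R] (fun x : R => pker b (z - x)).
Proof. by apply: (measurableT_comp (measurable_pker b)); exact: measurable_funB. Qed.

Lemma measurable_conv a b (z : R) :
  measurable_fun [set: R] (fun x => (pker a x * pker b (z - x))%:E).
Proof.
apply/measurable_EFinP/measurable_funM; first exact: measurable_pker.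
exact: measurable_pkerB.
Qed.

(** Substituting x = z u pulls out all the powers of z. *)
Lemma conv_pker a b (z : R) : 0 < z ->
  (\int[mu]_x (pker a x * pker b (z - x))%:E = (z `^ (a + b - 1))%:E * BetaE a b)%E.
Proof.
move=> z0.
have z0' : z != 0 by rewrite gt_eqF.
rewrite (ge0_integral_affmap 0 z0'); last 2 first.
- exact: measurable_conv.
- by move=> x; rewrite lee_fin mulr_ge0 ?pker_ge0.
rewrite (gtr0_norm z0).
transitivity (z%:E * \int[mu]_x ((z `^ (a + b - 2))%:E * (pker a x * pker b (1 - x))%:E))%E.
  congr (_ * _)%E; apply: eq_integral => x _; rewrite -EFinM; congr EFin.
  rewrite addr0 (_ : z - z * x = z * (1 - x)); last by rewrite mulrBr mulr1.
  rewrite !pkerM// mulrACA -powRDgt0//.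
  by congr (z `^ _ * _); ring.
rewrite ge0_integralZl//; last 3 first.
- exact: measurable_conv.
- by move=> x _; rewrite lee_fin mulr_ge0 ?pker_ge0.
- by rewrite lee_fin powR_ge0.
rewrite muleA -EFinM; congr (_%:E * _)%E.
rewrite -[X in X * _](@powRr1 _ z) ?ltW// -powRDgt0//.
by congr (z `^ _); ring.
Qed.

Lemma conv_pker0 a b (z : R) : z <= 0 ->
  (\int[mu]_x (pker a x * pker b (z - x))%:E = 0)%E.
Proof.
move=> z0; apply: integral0_eq => x _.
have [x0|x0] := leP x 0; first by rewrite pker_le0E// mul0r.
by rewrite (@pker_le0E b) ?mulr0//; lra.
Qed.

(** Write the product of the two Gamma integrals as a double integral, put
y = z - x, and integrate in x first: [conv_pker] leaves a Gamma integral in z.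
No finiteness is assumed, as all integrands are nonnegative. *)
Lemma GammaE_mul a b : (GammaE a * GammaE b = BetaE a b * GammaE (a + b))%E.
Proof.
have mph c : measurable_fun [set: R] (fun x : R => (pker c x * expR (- x))%:E).
  apply/measurable_EFinP/measurable_funM; [exact: measurable_pker|exact: measurable_expRN].
have ph0 c x : (0 <= (pker c x * expR (- x))%:E :> \bar R)%E.
  by rewrite lee_fin mulr_ge0 ?pker_ge0 ?expR_ge0.
pose F (xz : R * R) : \bar R :=
  (pker a xz.1 * pker b (xz.2 - xz.1) * expR (- xz.2))%:E.
have mF : measurable_fun setT F.
  apply/measurable_EFinP/measurable_funM; first apply: measurable_funM.
  - by apply: (measurableT_comp (measurable_pker a)); exact: measurable_fst.
  - apply: (measurableT_comp (measurable_pker b)); apply: measurable_funB.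
      exact: measurable_snd.
    exact: measurable_fst.
  - by apply: (measurableT_comp measurable_expRN); exact: measurable_snd.
have F0 xz : (0 <= F xz)%E by rewrite lee_fin !mulr_ge0 ?pker_ge0 ?expR_ge0.
have inner (x : R) : ((pker a x * expR (- x))%:E * GammaE b = \int[mu]_z F (x, z))%E.
  rewrite /GammaE (ge0_integral_affmap (- x) (oner_neq0 R) (mph b) (ph0 b)).
  rewrite normr1 mul1e -ge0_integralZl; last 4 first.
  - exact: measurableT.
  - exact: (measurableT_comp (mph b) (measurable_affmap 1 (- x))).
  - by move=> z _; exact: ph0.
  - exact: ph0.
  apply: eq_integral => z _; rewrite mul1r /F/= -EFinM.
  congr EFin; rewrite opprB mulrACA -expRD; congr (_ * expR _); ring.
have -> : (GammaE a * GammaE b = \int[mu]_x \int[mu]_z F (x, z))%E.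
  rewrite -ge0_integralZr; last 4 first.
  - exact: measurableT.
  - exact: mph.
  - by move=> x _; exact: ph0.
  - exact: GammaE_ge0.
  by apply: eq_integral => x _; exact: inner.
transitivity (\int[mu]_z \int[mu]_x F (x, z))%E.
  exact: (fubini_tonelli (m1 := mu) (m2 := mu) F mF F0).
rewrite [X in (_ * X)%E]/GammaE -ge0_integralZl; last 4 first.
- exact: measurableT.
- exact: mph.
- by move=> x _; exact: ph0.
- exact: BetaE_ge0.
apply: eq_integral => z _.
transitivity ((expR (- z))%:E * \int[mu]_x (pker a x * pker b (z - x))%:E)%E.
  rewrite -ge0_integralZl; last 4 first.
  - exact: measurableT.
  - exact: measurable_conv.
  - by move=> x _; rewrite lee_fin mulr_ge0 ?pker_ge0.
  - by rewrite lee_fin expR_ge0.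
  by apply: eq_integral => x _; rewrite /F/= -EFinM mulrC.
have [z0|z0] := leP z 0.
  by rewrite conv_pker0// pker_le0E// mul0r !mule0.
by rewrite conv_pker// pker_gt0E// EFinM muleCA [RHS]muleC -muleA.
Qed.

End beta_gamma.

(** * The Gamma function *)

Section gamma.
Context {R : realType}.
Notation mu := (@lebesgue_measure R).

Lemma integral_powR_gt0 (a s t : R) : 0 < a -> 0 < s -> s < t ->
  (\int[mu]_(x in `[s, t]) (x `^ (a - 1))%:E = ((t `^ a - s `^ a) / a)%:E)%E.
Proof.
move=> a0 s0 st.
rewrite (@continuous_FTC2 _ _ (fun x => a^-1 * x `^ a))//.
- by rewrite -EFinB; congr EFin; ring.
- apply: continuous_in_subspaceT => x; rewrite inE/= in_itv/= => /andP[sx _].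
  by apply: powR_continuous; lra.
- have cF (x : R) : 0 < x -> {for x, continuous (fun x : R => a^-1 * x `^ a)}.
    by move=> x0; apply: cvgM; [exact: cvg_cst|exact: powR_continuous].
  split.
  + move=> x; rewrite in_itv/= => /andP[sx _].
    apply: derivableM => //.
    exact: (@ex_derive _ _ _ _ _ _ _ (is_derive1_powR a (lt_trans s0 sx))).
  + by apply: cvg_at_right_filter; apply: cF.
  + by apply: cvg_at_left_filter; apply: cF; lra.
- move=> x; rewrite in_itv/= => /andP[sx _].
  have x0 : 0 < x by lra.
  rewrite derive1Ml; last exact: (@ex_derive _ _ _ _ _ _ _ (is_derive1_powR a x0)).
  rewrite powR_derive1; last by rewrite in_itv/= x0.
  by rewrite mulrA mulVf ?mul1r// gt_eqF.
Qed.

(** The integrand may be singular at 0, so the integral is exhausted from the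
intervals [t / n, t] on which the fundamental theorem of calculus applies. *)
Lemma integral_powR0 (a t : R) : 0 < a -> 0 < t ->
  (\int[mu]_(x in `]0%R, t]) (x `^ (a - 1))%:E = (t `^ a / a)%:E)%E.
Proof.
move=> a0 t0.
pose F (n : nat) : set R := `[t / n.+2%:R, t]%classic.
have UF : `]0, t]%classic = \bigcup_n F n.
  apply/seteqP; split=> x; rewrite /F/= ?in_itv/=.
    move=> /andP[x0 xt].
    have := @cvg_harmonic R.
    move=> /cvgr0Pnorm_lt /(_ (x / t) (divr_gt0 x0 t0))[n _] /(_ n.+1 (leqnSn _)) /=.
    rewrite /harmonic/= ger0_norm ?invr_ge0// => h.
    exists n => //=; rewrite in_itv/= xt andbT.
    by move: h => /ltW; rewrite ler_pdivlMr// mulrC.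
  move=> [n _] /=; rewrite in_itv/= => /andP[h ->]; rewrite andbT.
  by apply: lt_le_trans h; rewrite divr_gt0.
have mf : measurable_fun [set: R] (fun x : R => (x `^ (a - 1))%:E).
  by apply/measurable_EFinP.
have cv : (\int[mu]_(x in F n) (x `^ (a - 1))%:E @[n --> \oo] -->
    \int[mu]_(x in `]0%R, t]) (x `^ (a - 1))%:E)%E.
  rewrite UF; apply: ge0_nondecreasing_set_cvg_integral.
  - move=> m n mn; apply/subsetPset => x; rewrite /F/= !in_itv/= => /andP[h ->].
    rewrite andbT; apply: le_trans h.
    by rewrite ler_pM2l// lef_pV2 ?posrE// ler_nat.
  - by move=> n; exact: measurable_itv.
  - by move=> n; apply: measurable_funS mf.
  - by move=> n x _; rewrite lee_fin powR_ge0.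
have cv2 : (\int[mu]_(x in F n) (x `^ (a - 1))%:E @[n --> \oo] --> (t `^ a / a)%:E)%E.
  under eq_cvg do rewrite integral_powR_gt0 ?divr_gt0 ?ltr_pdivrMr ?ltr_pMr ?ltr1n//.
  apply: cvg_EFin; first exact: nearW.
  apply: cvgMl.
  rewrite -[X in _ --> X]subr0; apply: cvgB; first exact: cvg_cst.
  move/cvg_at_rightP: (powR_cvg0 a0) => H.
  apply: (H (fun n : nat => t / n.+2%:R)); split=> [n|]; first by rewrite divr_gt0.
  rewrite -[X in _ --> X](mulr0 t); apply: cvgM; first exact: cvg_cst.
  have := @cvg_harmonic R.
  by rewrite -cvg_shiftS.
have H := cvg_unique _ cv cv2; exact: H.
Qed.

Lemma GammaE1 : GammaE (1 : R) = 1%E.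
Proof.
rewrite -(integral_exponential_pdf (ltr01 : 0 < 1 :> R)).
rewrite /exponential_pdf.
transitivity (\int[mu]_(x in `]0%R, +oo[) (expR (- x))%:E)%E.
  rewrite /GammaE [RHS]integral_mkcond; apply: eq_integral => x _.
  rewrite patchE mem_setE in_itv/= andbT /pker; case: ifPn => x0.
    by rewrite subrr powRr0 mul1r.
  by rewrite mul0r.
rewrite integral_itv_obnd_cbnd; last first.
  by apply/measurable_EFinP; apply: measurable_funTS; exact: measurable_expRN.
rewrite [LHS]integral_mkcond; apply: eq_integral => x _.
by rewrite !patchE; case: ifPn => // _; rewrite mul1r mulN1r.
Qed.

(** This special Beta value turns [GammaE_mul] into the functional equation of
Gamma, without an integration by parts. *)
Lemma BetaE1 (a : R) : 0 < a -> BetaE a 1 = (a^-1)%:E.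
Proof.
move=> a0; transitivity (\int[mu]_(x in `]0%R, 1%R[) (x `^ (a - 1))%:E)%E.
  rewrite /BetaE [RHS]integral_mkcond; apply: eq_integral => x _.
  rewrite patchE mem_setE in_itv/= /pker subr_gt0 subrr powRr0.
  by case: ifP => _ /=; case: ifP => _; rewrite ?(mulr0, mul0r, mulr1).
rewrite integral_itv_bndo_bndc; last first.
  by apply/measurable_EFinP; apply: measurable_funTS.
by rewrite integral_powR0// powR1 mul1r.
Qed.

Lemma GammaE_rec (a : R) : 0 < a -> GammaE a = ((a^-1)%:E * GammaE (a + 1))%E.
Proof. by move=> a0; rewrite -BetaE1// -GammaE_mul GammaE1 mule1. Qed.

Lemma GammaES (a : R) : 0 < a -> GammaE (a + 1) = (a%:E * GammaE a)%E.
Proof.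
by move=> a0; rewrite [X in (_ * X)%E]GammaE_rec// muleA -EFinM mulfV ?mul1e// gt_eqF.
Qed.

Lemma GammaE_nat (n : nat) : (GammaE (n.+1%:R : R) < +oo)%E.
Proof.
elim: n => [|n IH]; first by rewrite GammaE1 ltry.
rewrite -natr1 GammaES//; move: IH (GammaE_ge0 (n.+1%:R : R)).
by case: (GammaE _) => // r _ _; rewrite -EFinM ltry.
Qed.

Lemma measurable_GammaI (a : R) :
  measurable_fun [set: R] (fun x : R => (pker a x * expR (- x))%:E).
Proof.
by apply/measurable_EFinP/measurable_funM; [exact: measurable_pker|exact: measurable_expRN].
Qed.

(** Compare x^(a-1) with 1 + x^n for an integer n >= a - 1: the Gamma integral is
finite at integers by the functional equation. *)
Lemma GammaE_ge1_lty (a : R) : 1 <= a -> (GammaE a < +oo)%E.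
Proof.
move=> a1.
pose n := Num.truncn a.
have an : a <= n.+1%:R by apply: ltW; exact: truncnS_gt.
have F0 c (x : R) : (0 <= (pker c x * expR (- x))%:E :> \bar R)%E.
  by rewrite lee_fin mulr_ge0 ?pker_ge0 ?expR_ge0.
apply: (@le_lt_trans _ _ (GammaE 1 + GammaE (n.+1%:R : R))%E); last first.
  by rewrite GammaE1 lte_add_pinfty ?ltry// GammaE_nat.
rewrite /GammaE -ge0_integralD; last 5 first.
- exact: measurableT.
- by move=> x _; exact: F0.
- exact: measurable_GammaI.
- by move=> x _; exact: F0.
- exact: measurable_GammaI.
apply: ge0_le_integral.
- exact: measurableT.
- by move=> x _; exact: F0.
- exact: measurable_GammaI.
- by apply: emeasurable_funD; exact: measurable_GammaI.
move=> x _; rewrite -EFinD lee_fin -mulrDl ler_pM2r ?expR_gt0//.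
rewrite /pker; case: ifPn => x0; last by rewrite addr0.
rewrite subrr powRr0.
have [x1|x1] := leP x 1.
  have : x `^ (a - 1) <= x `^ 0 by rewrite ger_powR ?x0// subr_ge0.
  rewrite powRr0 => /le_trans; apply; rewrite lerDl powR_ge0//.
apply: (@le_trans _ _ (x `^ (n.+1%:R - 1))); last by rewrite lerDr.
by apply: ler_powR; lra.
Qed.

Lemma GammaE_lty (a : R) : 0 < a -> (GammaE a < +oo)%E.
Proof.
move=> a0; rewrite GammaE_rec//.
have : (GammaE (a + 1) < +oo)%E by apply: GammaE_ge1_lty; lra.
move: (GammaE_ge0 (a + 1)).
by case: (GammaE _) => // r _ _; rewrite -EFinM ltry.
Qed.

Lemma EFin_Gamma (a : R) : 0 < a -> (Gamma a)%:E = GammaE a.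
Proof.
move=> a0; rewrite fine_GammaE fineK// ge0_fin_numE ?GammaE_ge0//.
exact: GammaE_lty.
Qed.

(** Only the interval [M, M + 1] of the Gamma integral is kept. As M is
arbitrary, Gamma outgrows every geometric sequence, whence the convergence of
the Mittag-Leffler series. *)
Lemma Gamma_lower_bound (a M : R) : 1 <= a -> 0 < M ->
  M `^ (a - 1) * expR (- (M + 1)) <= Gamma a.
Proof.
move=> a1 M0; rewrite -lee_fin EFin_Gamma ?(lt_le_trans ltr01)//.
apply: (@le_trans _ _ (\int[mu]_(x in `[M, (M + 1%R)%R]) (pker a x * expR (- x))%:E)%E).
  have mu1 : lebesgue_measure `[M, M + 1]%classic = 1%E :> \bar R.
    by rewrite lebesgue_measure_itv/= lte_fin ltrDl ltr01 -EFinD [M + 1]addrC addrK.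
  have := @integral_cst _ _ R mu `[M, M + 1]%classic (measurable_itv _)
    (M `^ (a - 1) * expR (- (M + 1)))%:E.
  rewrite [X in (_ * X)%E](mu1) mule1 => <-.
  apply: ge0_le_integral => //.
  - by move=> x _; rewrite lee_fin mulr_ge0 ?powR_ge0 ?expR_ge0.
  - by apply: measurable_funTS; exact: measurable_GammaI.
  move=> x; rewrite /= in_itv/= => /andP[Mx xM].
  rewrite lee_fin pker_gt0E; last by apply: lt_le_trans Mx.
  apply: ler_pM; rewrite ?powR_ge0 ?expR_ge0//.
    apply: ge0_ler_powR => //; rewrite ?nnegrE ?subr_ge0//; lra.
  by rewrite ler_expR lerN2; lra.
apply: ge0_subset_integral => //.
- exact: measurable_GammaI.
- by move=> x _; rewrite lee_fin mulr_ge0 ?pker_ge0 ?expR_ge0.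
Qed.

Lemma GammaS (a : R) : 0 < a -> Gamma (a + 1) = a * Gamma a.
Proof.
move=> a0; apply: EFin_inj; rewrite EFinM !EFin_Gamma ?GammaES//; lra.
Qed.

Lemma Gamma_gt0 (a : R) : 0 < a -> 0 < Gamma a.
Proof.
move=> a0; rewrite -(pmulr_rgt0 _ a0) -GammaS//.
apply: lt_le_trans (@Gamma_lower_bound (a + 1) 1 _ _) => //; last by lra.
Qed.

Lemma Gamma_2sub (a : R) : a < 1 -> Gamma (2 - a) = (1 - a) * Gamma (1 - a).
Proof.
move=> a1; rewrite (_ : 2 - a = 1 - a + 1); last by ring.
by apply: GammaS; rewrite subr_gt0.
Qed.

Lemma BetaE_Gamma (a b : R) : 0 < a -> 0 < b ->
  BetaE a b = (Gamma a * Gamma b / Gamma (a + b))%:E.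
Proof.
move=> a0 b0; have ab0 : 0 < a + b by lra.
have := GammaE_mul a b; rewrite -!EFin_Gamma// -EFinM EFinM => h.
have := BetaE_ge0 a b; move: h (Gamma_gt0 ab0).
case: (BetaE a b) => // [r|].
  move=> /= [h] g0 _; congr EFin; rewrite h mulfK ?gt_eqF//.
by move=> + g0; rewrite gt0_mulye ?lte_fin//.
Qed.

End gamma.

(** * The Mittag-Leffler series *)

Section mittag.
Context {R : realType}.

Lemma Gamma1 : Gamma (1 : R) = 1.
Proof. by rewrite fine_GammaE GammaE1. Qed.

Definition mittag_leffler_term (a z : R) (k : nat) : R := z ^+ k / Gamma (1 + k%:R * a).

Lemma mittag_leffler_term_ge0 a z k : 0 < a -> 0 <= z -> 0 <= mittag_leffler_term a z k.
Proof.
move=> a0 z0; rewrite divr_ge0 ?exprn_ge0// ltW// Gamma_gt0//.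
by rewrite ltr_pwDl// mulr_ge0// ltW.
Qed.

(** With M^a = 2 z + 1, [Gamma_lower_bound] makes the k-th term at most
e^(M+1) (z / (2 z + 1))^k, and z / (2 z + 1) <= 1/2. *)
Lemma cvg_mittag_leffler (a z : R) : 0 < a -> 0 <= z -> cvgn (series (mittag_leffler_term a z)).
Proof.
move=> a0 z0.
(* z / M^a <= 1/2, and 2 z + 1 rather than 2 z keeps M positive when z = 0 *)
pose M := (2 * z + 1) `^ a^-1.
have M0 : 0 < M by rewrite powR_gt0//; lra.
have Ma : M `^ a = 2 * z + 1.
  by rewrite /M -powRrM mulVf ?gt_eqF// powRr1//; lra.
apply: (@series_le_cvg _ (mittag_leffler_term a z) (geometric (expR (M + 1)) 2^-1)).
- by move=> k; exact: mittag_leffler_term_ge0.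
- by move=> k; rewrite mulr_ge0 ?expR_ge0// exprn_ge0.
- move=> k.
  have ka : 0 <= k%:R * a by rewrite mulr_ge0// ltW.
  rewrite /mittag_leffler_term ler_pdivrMr; last by rewrite Gamma_gt0//; lra.
  have G : M `^ (k%:R * a) * expR (- (M + 1)) <= Gamma (1 + k%:R * a).
    by rewrite -{1}[k%:R * a](addKr 1) addrC; apply: Gamma_lower_bound => //; lra.
  apply: (@le_trans _ _ (geometric (expR (M + 1)) 2^-1 k
      * (M `^ (k%:R * a) * expR (- (M + 1))))).
    rewrite /geometric/= [M `^ _ * _]mulrC mulrACA -expRD subrr expR0 mul1r.
    rewrite [k%:R * a]mulrC powRrM Ma powR_mulrn; last by lra.
    rewrite -exprMn; apply: lerXn2r; rewrite ?nnegrE; lra.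
  by rewrite ler_wpM2l// mulr_ge0 ?expR_ge0// exprn_ge0.
- apply: is_cvg_geometric_series; rewrite ger0_norm//; lra.
Qed.

Lemma mittag_leffler_partial_le (a z : R) K : 0 < a -> 0 <= z ->
  series (mittag_leffler_term a z) K <= mittag_leffler a z.
Proof.
move=> a0 z0; apply: nondecreasing_cvgn_le; last exact: cvg_mittag_leffler.
by apply: nondecreasing_series => k _ _; exact: mittag_leffler_term_ge0.
Qed.

Lemma mittag_leffler_le (a z1 z2 : R) : 0 < a -> 0 <= z1 -> z1 <= z2 ->
  mittag_leffler a z1 <= mittag_leffler a z2.
Proof.
move=> a0 z0 z12; have z20 := le_trans z0 z12.
apply: ler_lim; [exact: cvg_mittag_leffler|exact: cvg_mittag_leffler|].
apply: nearW => K; rewrite /series/=; apply: ler_sum => k _.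
rewrite ler_pM2r ?invr_gt0 ?Gamma_gt0//; last by rewrite ltr_pwDl// mulr_ge0// ltW.
exact: lerXn2r.
Qed.

Lemma mittag_leffler_ge1 (a z : R) : 0 < a -> 0 <= z -> 1 <= mittag_leffler a z.
Proof.
move=> a0 z0; have := @mittag_leffler_partial_le a z 1 a0 z0.
by rewrite /series/= big_nat1 /mittag_leffler_term expr0 mul0r addr0 Gamma1 divr1.
Qed.

End mittag.

(** * Complementary coefficients *)

Lemma exchange_triangular (R : realType) (F : nat -> nat -> R) n :
  \sum_(1 <= k < n) \sum_(1 <= j < k.+1) F k j =
  \sum_(1 <= j < n) \sum_(j <= k < n) F k j.
Proof.
elim: n => [|[|n] IH]; first by rewrite !big_geq.
  by rewrite !big_geq.
rewrite big_nat_recr//= IH [RHS]big_nat_recr//= big_nat1.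
rewrite (@big_nat_recr _ _ _ n.+1 1 (F n.+1))//= addrA; congr (_ + _).
rewrite -big_split/=; apply: eq_big_nat => j /andP[_ jn].
by rewrite [RHS]big_nat_recr//; exact: ltnW.
Qed.

Section complementary.
Context {R : realType}.
Variables (N : nat) (g : nat -> nat -> R).
Hypothesis g_gt0 : forall n j, (1 <= j <= n)%N -> (n <= N)%N -> 0 < g n j.
Hypothesis g_homo : forall n j, (1 <= j < n)%N -> (n <= N)%N -> g n j <= g n j.+1.

Lemma compl_ge0 n i : (1 <= i <= n)%N -> (n <= N)%N -> 0 <= compl g n i.
Proof.
move=> /andP[i1 iN] nN.
have [d le_d] := ubnP (n - i)%N.
elim: d i i1 iN le_d => // d IH i i1 iN le_d.
have [->|ne_in] := eqVneq i n.
  by rewrite compl_nn invr_ge0 ltW// g_gt0// (leq_trans i1)/=.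
have lt_in : (i < n)%N by rewrite ltn_neqAle ne_in.
rewrite compl_lt// mulr_ge0// ?invr_ge0.
  by rewrite ltW// g_gt0 ?i1 ?leqnn// (leq_trans iN).
rewrite big_nat_cond sumr_ge0// => k /andP[/andP[ik kn] _].
rewrite mulr_ge0 ?subr_ge0 ?g_homo ?i1//; first by rewrite (leq_trans _ nN).
apply: IH => //; first exact: leq_trans i1 (ltnW ik).
by rewrite -ltnS (leq_trans _ le_d)// ltnS; apply: ltn_sub2l.
Qed.

(** The recursion for p says exactly that the sum for j equals the sum for
j + 1. *)
Lemma compl_sum n j : (1 <= j <= n)%N -> (n <= N)%N ->
  \sum_(j <= k < n.+1) compl g n k * g k j = 1.
Proof.
move=> /andP[j1 jn] nN.
have [d le_d] := ubnP (n - j)%N.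
elim: d j j1 jn le_d => // d IH j j1 jn le_d.
have [->|ne_jn] := eqVneq j n.
  by rewrite big_nat1 compl_nn mulVf// gt_eqF// g_gt0// (leq_trans j1)/=.
have lt_jn : (j < n)%N by rewrite ltn_neqAle ne_jn.
rewrite big_ltn// compl_lt//.
rewrite mulrAC mulVf ?mul1r; last first.
  by rewrite gt_eqF// g_gt0 ?j1 ?leqnn// (leq_trans jn).
rewrite -big_split/= -[RHS](IH j.+1)//; last 1 first.
  by rewrite -ltnS (leq_trans _ le_d)// ltnS; apply: ltn_sub2l.
by apply: eq_bigr => k _; ring.
Qed.

(** The sums stop at k = n - 1, hence the inequality: in the exchanged double sum
the inner sums lack the nonnegative term k = n of [compl_sum]. *)
Lemma sum_compl_le n (w : nat -> R) : (n <= N)%N -> (forall j, (1 <= j < n)%N -> 0 <= w j) ->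
  \sum_(1 <= k < n) compl g n k * (\sum_(1 <= j < k.+1) g k j * w j) <=
  \sum_(1 <= j < n) w j.
Proof.
move=> nN w0.
under eq_bigr do rewrite big_distrr/=.
rewrite exchange_triangular; apply: ler_sum_nat => j /andP[j1 jn].
rewrite -[leRHS]mul1r -(@compl_sum n j) ?j1 ?(ltnW jn)//= big_distrl/=.
rewrite big_nat_recr ?(ltnW jn)//=.
under eq_bigr do rewrite mulrA.
rewrite lerDl; apply: mulr_ge0; last by apply: w0; rewrite j1.
apply: mulr_ge0; first by apply: compl_ge0 => //; rewrite leqnn (leq_trans j1 (ltnW jn)).
by apply/ltW/g_gt0 => //; rewrite j1 ltnW.
Qed.

Lemma sum_compl_deriv n (w : nat -> R) : (n <= N)%N ->
  \sum_(1 <= k < n.+1) compl g n k * discrete_deriv g w k = w n - w 0%N.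
Proof.
move=> nN; rewrite /discrete_deriv.
under eq_bigr do rewrite big_distrr/=.
rewrite exchange_triangular.
transitivity (\sum_(1 <= j < n.+1) (w j - w j.-1)).
  apply: eq_big_nat => j /andP[j1 jn].
  rewrite -[RHS]mul1r -(@compl_sum n j) ?j1//= big_distrl/=.
  by apply: eq_bigr => k _; rewrite mulrA.
by rewrite -telescope_sumr// big_add1.
Qed.

End complementary.

(** * The Gronwall induction *)

Section max1.
Context {R : realType}.
Implicit Types F : nat -> R.

Lemma max1_ge n F k : (1 <= k <= n)%N -> F k <= max1 n F.
Proof.
move=> k1n; rewrite /max1; apply: (@le_bigmax_seq _ _ _ _ _ k xpredT) => //.
by rewrite mem_index_iota ltnS.
Qed.

Lemma max1_le n F M : (0 < n)%N -> (forall k, (1 <= k <= n)%N -> F k <= M) ->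
  max1 n F <= M.
Proof.
move=> n0 FM; rewrite /max1 big_nat_cond; apply: bigmax_le => [|k].
  by apply: FM; rewrite n0.
by rewrite andbT ltnS; exact: FM.
Qed.

Lemma max1_homo i n F : (0 < i <= n)%N -> max1 i F <= max1 n F.
Proof.
move=> /andP[i0 i_n]; apply: max1_le => // k /andP[k1 ki].
by apply: max1_ge; rewrite k1 (leq_trans ki).
Qed.

Lemma min1_le n F k : (1 <= k <= n)%N -> min1 n F <= F k.
Proof.
move=> k1n; rewrite /min1; apply: (@ge_bigmin_seq _ _ _ _ _ k xpredT) => //.
by rewrite mem_index_iota ltnS.
Qed.

Lemma min1_gt n F M : (0 < n)%N -> (forall k, (1 <= k <= n)%N -> M < F k) ->
  M < min1 n F.
Proof.
move=> n0 FM; rewrite /min1 big_nat_cond; elim/big_ind: _ => [|x y Mx My|k].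
- by apply: FM; rewrite n0.
- by rewrite lt_min Mx.
- by rewrite andbT ltnS; exact: FM.
Qed.

End max1.

Section gronwall.
Context {R : realType}.
Variables (N : nat) (g : nat -> nat -> R) (sigma : nat -> R).
Hypothesis g_gt0 : forall n j, (1 <= j <= n)%N -> (n <= N)%N -> 0 < g n j.
Hypothesis g_homo : forall n j, (1 <= j < n)%N -> (n <= N)%N -> g n j <= g n j.+1.
Hypothesis sigma01 : forall n, (1 <= n <= N)%N -> 0 <= sigma n <= 1.
Variables (lambda : nat -> R) (Lambda : R) (xi zeta v F : nat -> R).
Hypothesis lambda_ge0 : forall i, (i < N)%N -> 0 <= lambda i.
Hypothesis sum_lambda : \sum_(0 <= i < N) lambda i <= Lambda.
Hypothesis xi_ge0 : forall n, (1 <= n)%N -> 0 <= xi n.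
Hypothesis zeta_ge0 : forall n, (1 <= n)%N -> 0 <= zeta n.
Hypothesis v_ge0 : forall n, 0 <= v n.
Hypothesis deriv_le : forall n, (1 <= n <= N)%N ->
  discrete_deriv g (fun j => v j ^+ 2) n <=
    \sum_(1 <= k < n.+1) lambda (n - k)%N * shifted sigma v k ^+ 2
    + xi n * shifted sigma v n + zeta n ^+ 2.
Hypothesis diag_large : forall n, (1 <= n <= N)%N -> 2 * Lambda <= g n n.
Hypothesis F_ge2 : forall n, (1 <= n <= N)%N -> 2 <= F n.
Hypothesis F_homo : forall i n, (1 <= i <= n)%N -> (n <= N)%N -> F i <= F n.
Hypothesis sum_compl_F : forall n, (1 <= n <= N)%N ->
  2 * Lambda * \sum_(1 <= j < n) compl g n j * F j <= F n - 2.

Let Psi n : R := v 0%N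
  + max1 n (fun k => \sum_(1 <= j < k.+1) compl g k j * (xi j + zeta j))
  + max1 n zeta.

Lemma sum_lambda_le k : (k <= N)%N ->
  \sum_(1 <= i < k.+1) lambda (k - i)%N <= Lambda.
Proof.
move=> kN; apply: le_trans sum_lambda.
have -> : \sum_(1 <= i < k.+1) lambda (k - i)%N = \sum_(0 <= i < k) lambda i.
  by rewrite big_add1/= [RHS]big_nat_rev/=; apply: eq_bigr.
rewrite (big_cat_nat _ kN)//= lerDl big_nat_cond sumr_ge0// => i.
by rewrite andbT => /andP[_]; exact: lambda_ge0.
Qed.

Lemma shifted_ge0 k : (1 <= k <= N)%N -> 0 <= shifted sigma v k.
Proof.
move=> /sigma01/andP[s0 s1].
by rewrite /shifted addr_ge0// mulr_ge0// subr_ge0.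
Qed.

Lemma shifted_le k M : (1 <= k <= N)%N -> v k <= M -> v k.-1 <= M ->
  shifted sigma v k <= M.
Proof.
move=> /sigma01/andP[s0 s1] h1 h2.
rewrite /shifted; have : (1 - sigma k) * v k <= (1 - sigma k) * M.
  by rewrite ler_wpM2l// subr_ge0.
have : sigma k * v k.-1 <= sigma k * M by rewrite ler_wpM2l.
lra.
Qed.

Lemma Psi_homo i n : (0 < i <= n)%N -> Psi i <= Psi n.
Proof. by move=> h; rewrite /Psi !lerD ?max1_homo. Qed.

Lemma Psi_ge n : (1 <= n <= N)%N ->
  [/\ v 0%N <= Psi n, max1 n zeta <= Psi n &
   v 0%N + \sum_(1 <= j < n.+1) compl g n j * (xi j + zeta j) <= Psi n].
Proof.
move=> /andP[n1 nN].
have z0 : 0 <= max1 n zeta by apply: le_trans (@max1_ge _ n zeta 1 _); rewrite ?zeta_ge0.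
set S := fun k => \sum_(1 <= j < k.+1) compl g k j * (xi j + zeta j).
have S0 : 0 <= S n.
  rewrite /S big_nat_cond sumr_ge0// => j /andP[/andP[j1 jn] _].
  by rewrite mulr_ge0 ?addr_ge0 ?xi_ge0 ?zeta_ge0// (compl_ge0 g_gt0 g_homo)// j1.
have Sn : S n <= max1 n S by apply: max1_ge; rewrite n1 leqnn.
have v0 := v_ge0 0.
rewrite /Psi -/S -/(S n); split; lra.
Qed.

(** One factor of every square is bounded by V so that V can be divided out
later; the bound C of the other factor is kept apart because it is V at the
last index and the induction hypothesis before. *)
Lemma source_le k V C : (1 <= k <= N)%N -> 0 <= V ->
  (forall i, (1 <= i <= k)%N -> shifted sigma v i <= V) ->
  (forall i, (1 <= i <= k)%N -> shifted sigma v i <= C) -> zeta k <= V ->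
  \sum_(1 <= i < k.+1) lambda (k - i)%N * shifted sigma v i ^+ 2
    + xi k * shifted sigma v k + zeta k ^+ 2 <= V * (Lambda * C + (xi k + zeta k)).
Proof.
move=> /[dup] k1N /andP[k1 kN] V0 sV sC zV.
have hk : (1 <= k <= k)%N by rewrite k1 leqnn.
have s0 i : (1 <= i <= k)%N -> 0 <= shifted sigma v i.
  by move=> /andP[i1 ik]; apply: shifted_ge0; rewrite i1 (leq_trans ik).
have C0 : 0 <= C := le_trans (s0 _ hk) (sC _ hk).
have h1 : \sum_(1 <= i < k.+1) lambda (k - i)%N * shifted sigma v i ^+ 2 <= V * (Lambda * C).
  apply: (@le_trans _ _ (\sum_(1 <= i < k.+1) lambda (k - i)%N * (V * C))).
    apply: ler_sum_nat => i /andP[i1 ik].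
    have hi : (1 <= i <= k)%N by rewrite i1.
    rewrite ler_wpM2l ?lambda_ge0//; last by rewrite expr2 ler_pM ?s0 ?sV ?sC.
    rewrite (leq_trans _ kN)// -subSn// leq_subLR.
    by case: (i) i1 => // i' _; rewrite addSn ltnS leq_addl.
  by rewrite -big_distrl/= [leRHS]mulrCA ler_wpM2r ?mulr_ge0 ?sum_lambda_le.
have h2 : xi k * shifted sigma v k <= V * xi k by rewrite mulrC ler_wpM2r ?xi_ge0 ?sV.
have h3 : zeta k ^+ 2 <= V * zeta k by rewrite expr2 ler_wpM2r ?zeta_ge0.
rewrite (mulrDr V) (mulrDr V (xi k)) -addrA; apply: (lerD h1 (lerD h2 h3)).
Qed.

(** Strong induction on n. If some earlier value is at least [v n], or some zeta
is, the bound is inherited; otherwise every term of the summed inequality has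
[v n] as a factor. *)
Lemma discrete_gronwall n : (1 <= n <= N)%N -> v n <= F n * Psi n.
Proof.
have [d] := ubnP n; elim: d n => // d IH n le_d /[dup] n1N /andP[n1 nN].
have [v0P zP SP] := Psi_ge n1N.
have P0 : 0 <= Psi n := le_trans (v_ge0 0) v0P.
have F2 := F_ge2 n1N.
have PF : Psi n <= F n * Psi n by rewrite ler_peMl//; lra.
have FP i : (1 <= i < n)%N -> v i <= F i * Psi n.
  move=> /andP[i1 i_n].
  have i1N : (1 <= i <= N)%N by rewrite i1 (leq_trans (ltnW i_n)).
  have id : (i < d)%N by apply: leq_trans i_n _; rewrite -ltnS.
  apply: (le_trans (IH _ id i1N)); apply: ler_wpM2l.
    by apply: le_trans (F_ge2 i1N).
  by apply: Psi_homo; rewrite i1 ltnW.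
have [hmax|] := boolP [forall i : 'I_n, v i <= v n]; last first.
  move=> /forallPn[/= [i i_n] /=]; rewrite -ltNge => /ltW vni.
  apply: (le_trans vni); case: (posnP i) => [->|i0]; first exact: le_trans PF.
  apply: (le_trans (FP i _)); first by rewrite i0.
  by rewrite ler_wpM2r// F_homo// i0 ltnW.
have {}hmax i : (i <= n)%N -> v i <= v n.
  rewrite leq_eqVlt => /predU1P[->//|i_n].
  by move/forallP/(_ (Ordinal i_n)): hmax.
have [Vz|zV] := leP (v n) (max1 n zeta); first exact: le_trans Vz (le_trans zP PF).
have {}zV k : (1 <= k <= n)%N -> zeta k <= v n.
  by move=> hk; apply: le_trans (max1_ge _ hk) (ltW zV).
have [V0|V_le0] := ltP 0 (v n); last exact: le_trans V_le0 (le_trans P0 PF).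
have sV k : (1 <= k <= n)%N -> shifted sigma v k <= v n.
  move=> /andP[k1 kn]; apply: shifted_le; first by rewrite k1 (leq_trans kn).
    exact: hmax.
  by apply: hmax; rewrite (leq_trans (leq_pred _)).
(* at the last index the induction hypothesis is not available for v n itself *)
pose C k := if (k < n)%N then F k * Psi n else v n.
have sC k i : (1 <= i <= k)%N -> (k <= n)%N -> shifted sigma v i <= C k.
  move=> /andP[i1 ik]; rewrite /C leq_eqVlt => /predU1P[kn|kn].
    by rewrite kn ltnn; apply: sV; rewrite i1 -kn.
  rewrite kn.
  have k1N : (1 <= k <= N)%N by rewrite (leq_trans i1 ik) (leq_trans (ltnW kn)).
  have vC j : (j <= k)%N -> v j <= F k * Psi n.
    move=> jk; case: (posnP j) => [->|j0].
      by apply: (le_trans v0P); rewrite ler_peMl// (le_trans _ (F_ge2 k1N))// ler1n.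
    apply: (le_trans (FP j _)); first by rewrite j0 (leq_ltn_trans jk).
    by rewrite ler_wpM2r// F_homo ?j0// (leq_trans (ltnW kn)).
  apply: shifted_le; [by rewrite i1 (leq_trans ik)//; case/andP: k1N|exact: vC|].
  by apply: vC; rewrite (leq_trans (leq_pred _)).
have p0 k : (1 <= k <= n)%N -> 0 <= compl g n k.
  by move=> hk; exact: (compl_ge0 g_gt0 g_homo).
have := sum_compl_deriv g_gt0 (fun j => v j ^+ 2) nN.
set S := \sum_(1 <= k < n.+1) _ => SE.
have : S <= \sum_(1 <= k < n.+1) compl g n k * (v n * (Lambda * C k + (xi k + zeta k))).
  apply: ler_sum_nat => k /andP[k1 kn]; rewrite ler_wpM2l ?p0 ?k1//.
  have k1N : (1 <= k <= N)%N by rewrite k1 (leq_trans _ nN).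
  apply: (le_trans (deriv_le k1N)); apply: source_le => //.
  - by move=> i /andP[i1 ik]; apply: sV; rewrite i1 (leq_trans ik).
  - by move=> i hi; exact: sC.
  - by apply: zV; rewrite k1.
have -> : \sum_(1 <= k < n.+1) compl g n k * (v n * (Lambda * C k + (xi k + zeta k))) =
   v n * (Lambda * (\sum_(1 <= k < n) compl g n k * F k) * Psi n +
     Lambda * (g n n)^-1 * v n + \sum_(1 <= k < n.+1) compl g n k * (xi k + zeta k)).
  transitivity (v n * (Lambda * (\sum_(1 <= k < n.+1) compl g n k * C k)
     + \sum_(1 <= k < n.+1) compl g n k * (xi k + zeta k))).
    rewrite !big_distrr/= -big_split/= big_distrr/=; apply: eq_bigr => k _; ring.
  congr (_ * (_ + _)); rewrite big_nat_recr//= /C ltnn compl_nn.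
  rewrite -[Lambda * _ * _]mulrA big_distrl/=.
  rewrite mulrDr mulrA; congr (_ * _ + _).
  by apply: eq_big_nat => k /andP[_ kn]; rewrite kn mulrA.
move=> H.
(* the term of index n is absorbed: this is where the step size matters *)
have gn : Lambda * (g n n)^-1 * v n <= v n / 2.
  rewrite mulrC ler_wpM2l ?(ltW V0)// ler_pdivrMr; last first.
    by apply: g_gt0 => //; rewrite n1 leqnn.
  by have := diag_large n1N; lra.
have v02 : v 0%N ^+ 2 <= v n * v 0%N by rewrite expr2 ler_wpM2r// hmax.
have {}H : v n * v n <= v n * (v 0%N +
    (Lambda * (\sum_(1 <= k < n) compl g n k * F k) * Psi n +
     v n / 2 + \sum_(1 <= k < n.+1) compl g n k * (xi k + zeta k))).
  rewrite mulrDr.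
  apply: (@le_trans _ _ (v n * v 0%N + S)); first by rewrite SE expr2; lra.
  rewrite lerD2l (le_trans H)// ler_wpM2l ?(ltW V0)// lerD2r lerD2l//.
move: H; rewrite ler_pM2l// => H.
have := ler_wpM2r P0 (sum_compl_F n1N); rewrite mulrBl -mulrA -mulrA => K.
rewrite -mulrA in H; lra.
Qed.

End gronwall.

(** * Chebyshev inequality for integrals *)

Section chebyshev.
Context {R : realType}.
Notation mu := (@lebesgue_measure R).

(** Expand the hypothesis and integrate it in s and then in s'; doing this with
one-variable integrals avoids the product measure. *)
Lemma Rintegral_chebyshev (x y : R) (f w : R -> R) : x < y ->
  mu.-integrable `]x, y[ (EFin \o f) -> mu.-integrable `]x, y[ (EFin \o w) ->
  mu.-integrable `]x, y[ (EFin \o (fun s => f s * w s)) ->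
  (forall s s', x < s < y -> x < s' < y -> (f s - f s') * (w s - w s') <= 0) ->
  (y - x) * \int[mu]_(s in `]x, y[) (f s * w s) <=
  (\int[mu]_(s in `]x, y[) f s) * (\int[mu]_(s in `]x, y[) w s).
Proof.
move=> xy fi wi fwi mono.
set D := `]x, y[%classic; set Fh := \int[mu]_(s in D) f s; set Wh := \int[mu]_(s in D) w s.
set P := \int[mu]_(s in D) (f s * w s).
have mD : measurable (D : set (measurableTypeR R)) by exact: measurable_itv.
have muD : mu D = (y - x)%:E by rewrite lebesgue_measure_itv/= lte_fin xy.
have icst (k : R) : mu.-integrable D (EFin \o cst k).
  apply/integrableP; split; first exact/measurable_EFinP/measurable_cst.
  have := @integral_cst _ _ R mu D mD (`|k|)%:E; rewrite /= muD -EFinM => ->.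
  exact: ltry.
have iZ (k : R) (h : R -> R) : mu.-integrable D (EFin \o h) ->
    mu.-integrable D (EFin \o (fun s => k * h s)).
  by move=> hi; exact: (@integrableZl _ _ _ mu D mD k (EFin \o h) hi).
have iD (h1 h2 : R -> R) : mu.-integrable D (EFin \o h1) -> mu.-integrable D (EFin \o h2) ->
    mu.-integrable D (EFin \o (fun s => h1 s + h2 s)).
  by move=> h1i h2i; exact: (@integrableD _ _ _ mu D mD (EFin \o h1) (EFin \o h2)).
have intC k : \int[mu]_(s in D) k = k * (y - x).
  by rewrite Rintegral_cst// -[RHS]/(k * fine (y - x)%:E) -muD.
have step1 s' : x < s' < y ->
    P + (y - x) * (f s' * w s') <= w s' * Fh + f s' * Wh.
  move=> xs'y.
  have H : \int[mu]_(s in D) (f s * w s + f s' * w s') <=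
      \int[mu]_(s in D) (w s' * f s + f s' * w s).
    apply: le_Rintegral => //.
    - exact: (iD _ _ fwi (icst _)).
    - exact: (iD _ _ (iZ _ _ fi) (iZ _ _ wi)).
    move=> s; rewrite /D/= in_itv/= => xsy.
    have := mono _ _ xsy xs'y; lra.
  rewrite (RintegralD mD fwi (icst (f s' * w s'))) in H.
  rewrite (RintegralD mD (iZ (w s') _ fi) (iZ (f s') _ wi)) in H.
  rewrite (RintegralZl _ mD fi) (RintegralZl _ mD wi) (intC (f s' * w s')) in H.
  by rewrite [_ * (f s' * w s')]mulrC.
have H : \int[mu]_(s in D) (P + (y - x) * (f s * w s)) <=
    \int[mu]_(s in D) (Fh * w s + Wh * f s).
  apply: le_Rintegral => //.
  - exact: (iD _ _ (icst P) (iZ _ _ fwi)).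
  - exact: (iD _ _ (iZ _ _ wi) (iZ _ _ fi)).
  move=> s; rewrite /D/= in_itv/= => xsy.
  by rewrite [Wh * _]mulrC [Fh * _]mulrC; exact: step1.
rewrite (RintegralD mD (icst P) (iZ (y - x) _ fwi)) in H.
rewrite (RintegralD mD (iZ Fh _ wi) (iZ Wh _ fi)) in H.
rewrite !(RintegralZl _ mD) ?(intC P)// in H.
rewrite -/P -/Fh -/Wh in H; lra.
Qed.

End chebyshev.

(** * Abel kernels on an interval *)

Section kernels.
Context {R : realType}.
Notation mu := (@lebesgue_measure R).

Lemma ge0_integrable (D : set (measurableTypeR R)) (f : R -> R) : measurable D ->
  measurable_fun [set: R] f -> (forall x, 0 <= f x) ->
  (\int[mu]_(x in D) (f x)%:E < +oo)%E -> mu.-integrable D (EFin \o f).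
Proof.
move=> mD mf f0 fin; apply/integrableP; split.
  by apply/measurable_EFinP; exact: measurable_funTS.
rewrite (_ : (\int[mu]_(x in D) `|(EFin \o f) x|)%E = (\int[mu]_(x in D) (f x)%:E)%E)//.
by apply: eq_integral => x _ /=; rewrite ger0_norm.
Qed.

Lemma integral_pker (A x y : R) : 0 < A -> 0 <= x -> x < y ->
  (\int[mu]_(s in `]x, y[) (pker A s)%:E = ((y `^ A - x `^ A) / A)%:E)%E.
Proof.
move=> A0 x0 xy.
have mp : measurable_fun `]x, y[%classic (fun s : R => (s `^ (A - 1))%:E).
  by apply/measurable_EFinP; apply: measurable_funTS.
transitivity (\int[mu]_(s in `]x, y[) (s `^ (A - 1))%:E)%E.
  apply: eq_integral => s; rewrite inE/= in_itv/= => /andP[xs _].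
  by rewrite pker_gt0E// (le_lt_trans x0).
move: x0; rewrite le_eqVlt => /predU1P[x0|x0]; last first.
  by rewrite -(integral_itv_bndoo true false mp) integral_powR_gt0.
rewrite -(integral_itv_bndoo false false mp) -x0 integral_powR0//; last by rewrite x0.
by rewrite powR0 ?subr0// gt_eqF.
Qed.

Lemma integrable_pker (A x y : R) : 0 < A -> 0 <= x -> x < y ->
  mu.-integrable `]x, y[ (EFin \o pker A).
Proof.
move=> A0 x0 xy; apply: ge0_integrable.
- exact: measurable_itv.
- exact: measurable_pker.
- by move=> s; exact: pker_ge0.
- by rewrite integral_pker// ltry.
Qed.

Lemma integral_reflect (t x y : R) (f : R -> \bar R) :
  measurable_fun [set: R] f -> (forall x, 0 <= f x)%E ->
  (\int[mu]_(s in `]x, y[) f (t - s)%R = \int[mu]_(s in `](t - y)%R, (t - x)%R[) f s)%E.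
Proof.
move=> mf f0.
have m1 : (- 1 : R) != 0 by rewrite oppr_eq0 oner_eq0.
rewrite [RHS]integral_mkcond.
rewrite (ge0_integral_affmap t m1); last 2 first.
- by apply/(measurable_restrictT _ _).1 => //; exact: measurable_funTS.
- by move=> s; apply: erestrict_ge0.
rewrite normrN normr1 mul1e [LHS]integral_mkcond; apply: eq_integral => s _.
rewrite !patchE !mem_setE !in_itv/= mulN1r [- s + t]addrC.
rewrite ltrD2l ltrD2l ltrN2 ltrN2 andbC.
by [].
Qed.

Lemma integral_pkerB (b t x y : R) : 0 < b -> x < y -> y <= t ->
  (\int[mu]_(s in `]x, y[) (pker b (t - s))%:E = (((t - x) `^ b - (t - y) `^ b) / b)%:E)%E.
Proof.
move=> b0 xy yt.
rewrite (@integral_reflect t x y (fun s => (pker b s)%:E)); last 2 first.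
- by apply/measurable_EFinP; exact: measurable_pker.
- by move=> s; rewrite lee_fin pker_ge0.
by rewrite integral_pker//; lra.
Qed.

Lemma integrable_pkerB (b t x y : R) : 0 < b -> x < y -> y <= t ->
  mu.-integrable `]x, y[ (EFin \o (fun s => pker b (t - s))).
Proof.
move=> b0 xy yt; apply: ge0_integrable.
- exact: measurable_itv.
- exact: measurable_pkerB.
- by move=> s; exact: pker_ge0.
- by rewrite integral_pkerB// ltry.
Qed.

(** The semigroup property of the Abel kernels, in the form of Euler's Beta
integral. *)
Lemma integral_conv (A b t : R) : 0 < A -> 0 < b -> 0 < t ->
  (\int[mu]_(s in `]0%R, t[) (pker A s * pker b (t - s))%:E =
    (t `^ (A + b - 1) * (Gamma A * Gamma b / Gamma (A + b)))%:E)%E.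
Proof.
move=> A0 b0 t0; rewrite EFinM -BetaE_Gamma// -conv_pker//.
rewrite [LHS]integral_mkcond; apply: eq_integral => s _.
rewrite patchE mem_setE in_itv/=; case: (ltP 0 s) => s0; last first.
  by rewrite /= pker_le0E// mul0r.
case: (ltP s t) => //= st.
by rewrite (@pker_le0E _ b) ?mulr0// subr_le0.
Qed.

Lemma integrable_conv (A b t x y : R) : 0 < A -> 0 < b -> 0 < t -> 0 <= x -> y <= t ->
  mu.-integrable `]x, y[ (EFin \o (fun s => pker A s * pker b (t - s))).
Proof.
move=> A0 b0 t0 x0 yt.
apply: (@integrableS _ _ _ mu `]0, t[%classic).
- exact: measurable_itv.
- exact: measurable_itv.
- by apply: subset_itv; rewrite bnd_simp.
apply: ge0_integrable.
- exact: measurable_itv.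
- by apply: measurable_funM; [exact: measurable_pker|exact: measurable_pkerB].
- by move=> s; rewrite mulr_ge0 ?pker_ge0.
- by rewrite integral_conv// ltry.
Qed.

(** For exponents A, b <= 1 the first kernel decreases and the second, reflected,
increases, so Chebyshev's inequality bounds the mean of the product by the
product of the means. *)
Lemma conv_piece_decreasing (A b t x y : R) : 0 < A -> A <= 1 -> 0 < b -> b <= 1 ->
  0 <= x -> x < y -> y <= t ->
  (y - x) * \int[mu]_(s in `]x, y[) (pker A s * pker b (t - s)) <=
  ((y `^ A - x `^ A) / A) * (((t - x) `^ b - (t - y) `^ b) / b).
Proof.
move=> A0 A1 b0 b1 x0 xy yt.
have t0 : 0 < t by lra.
have E1 : \int[mu]_(s in `]x, y[) (pker A s) = (y `^ A - x `^ A) / A.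
  by rewrite /Rintegral integral_pker.
have E2 : \int[mu]_(s in `]x, y[) (pker b (t - s)) = ((t - x) `^ b - (t - y) `^ b) / b.
  by rewrite /Rintegral integral_pkerB.
rewrite -E1 -E2; apply: (@Rintegral_chebyshev _ x y (pker A) (fun s => pker b (t - s))) => //.
- exact: integrable_pker.
- exact: integrable_pkerB.
- exact: integrable_conv.
clear E1 E2.
have dec a (u v : R) : a <= 1 -> 0 < u -> u <= v -> pker a v <= pker a u.
  move=> a1 u0 uv; rewrite !pker_gt0E//; last exact: lt_le_trans uv.
  rewrite -[a - 1]opprB !powRN lef_pV2 ?posrE ?powR_gt0//; last exact: lt_le_trans uv.
  by rewrite ge0_ler_powR ?nnegrE ?subr_ge0//; lra.
move=> s s' /andP[xs sy] /andP[xs' s'y].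
have [ss'|s's] := leP s s'.
  rewrite mulr_ge0_le0// subr_cp0 dec//; lra.
rewrite mulr_le0_ge0// subr_cp0 dec//; lra.
Qed.

(** For A >= 1 Chebyshev's inequality points the wrong way; the first kernel is
replaced by its value at the right end. *)
Lemma conv_piece_increasing (A b t x y : R) : 1 <= A -> 0 < b ->
  0 <= x -> x < y -> y <= t ->
  \int[mu]_(s in `]x, y[) (pker A s * pker b (t - s)) <=
  y `^ (A - 1) * (((t - x) `^ b - (t - y) `^ b) / b).
Proof.
move=> A1 b0 x0 xy yt.
have t0 : 0 < t by lra.
have E2 : \int[mu]_(s in `]x, y[) (pker b (t - s)) = ((t - x) `^ b - (t - y) `^ b) / b.
  by rewrite /Rintegral integral_pkerB.
have mD : measurable (`]x, y[%classic : set (measurableTypeR R)) by exact: measurable_itv.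
rewrite -E2 -(RintegralZl _ mD (integrable_pkerB b0 xy yt)).
apply: (le_Rintegral mD).
- by apply: integrable_conv => //; lra.
- exact: (@integrableZl _ _ _ mu _ mD (y `^ (A - 1)) _ (integrable_pkerB b0 xy yt)).
move=> s; rewrite /= in_itv/= => /andP[xs sy].
rewrite ler_wpM2r ?pker_ge0// pker_gt0E; last by lra.
by rewrite ge0_ler_powR ?nnegrE//; lra.
Qed.

End kernels.

(** * Summation of kernels against the complementary coefficients *)

Section kernel_sum.
Context {R : realType}.
Notation mu := (@lebesgue_measure R).
Variables (N : nat) (t : nat -> R) (g : nat -> nat -> R) (alpha c : R).
Hypothesis alpha0 : 0 < alpha.
Hypothesis alpha1 : alpha < 1.
Hypothesis c0 : 0 <= c.
Hypothesis t0 : t 0%N = 0.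
Hypothesis t_incr : forall n, (1 <= n <= N)%N -> t n.-1 < t n.
Hypothesis step_homo : forall n, (1 <= n < N)%N -> step t n <= step t n.+1.
Hypothesis g_gt0 : forall n j, (1 <= j <= n)%N -> (n <= N)%N -> 0 < g n j.
Hypothesis g_homo : forall n j, (1 <= j < n)%N -> (n <= N)%N -> g n j <= g n j.+1.
Let b : R := 1 - alpha.
Hypothesis g_ge : forall n j, (1 <= j <= n)%N -> (n <= N)%N ->
  c * (((t n - t j.-1) `^ b - (t n - t j) `^ b) / b) <= Gamma b * (step t j * g n j).

Lemma mesh_le i j : (i <= j)%N -> (j <= N)%N -> t i <= t j.
Proof.
move=> ij; elim: j ij => [|j IH]; first by rewrite leqn0 => /eqP->.
rewrite leq_eqVlt => /predU1P[->//|]; rewrite ltnS => ij jN.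
by apply: (le_trans (IH ij (ltnW jN))); apply/ltW/(t_incr (n := j.+1)); rewrite jN.
Qed.

Lemma mesh_ge0 i : (i <= N)%N -> 0 <= t i.
Proof. by move=> iN; rewrite -t0 mesh_le. Qed.

Lemma mesh_gt0 i : (1 <= i <= N)%N -> 0 < t i.
Proof.
move=> /[dup] /t_incr h /andP[i1 iN]; apply: le_lt_trans h; apply: mesh_ge0.
by rewrite (leq_trans (leq_pred _)).
Qed.

Lemma Rintegral_mesh (h : R -> R) j : (j <= N)%N ->
  mu.-integrable `]0, t j[ (EFin \o h) ->
  \int[mu]_(s in `]0, t j[) h s =
  \sum_(1 <= i < j.+1) \int[mu]_(s in `]t i.-1, t i[) h s.
Proof.
elim: j => [|j IH] jN hi.
  by rewrite big_geq// t0 set_itvoo0 Rintegral_set0.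
have jj : t j < t j.+1 by apply: (t_incr (n := j.+1)).
have hj : mu.-integrable `]0, t j[ (EFin \o h).
  apply: integrableS hi; [exact: measurable_itv|exact: measurable_itv|].
  by apply: subset_itvl; rewrite bnd_simp ltW.
rewrite big_nat_recr//= -IH ?(ltnW jN)//.
rewrite -(Rintegral_itvB (x := t j) hi); last 2 first.
- by rewrite bnd_simp mesh_ge0// ltnW.
- by rewrite bnd_simp.
by rewrite (Rintegral_itv_bndo_bndc hj) addrC subrK.
Qed.

Section delta.
Variables (A : R) (delta : nat -> R) (n : nat).
Hypothesis A0 : 0 < A.
Hypothesis nN : (n <= N)%N.
Hypothesis delta_ge0 : forall i, (1 <= i < n)%N -> 0 <= delta i.
Hypothesis delta_ge : forall i j, (1 <= i <= j)%N -> (j < n)%N ->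
  c * \int[mu]_(s in `]t i.-1, t i[) (pker A s * pker b (t j - s)) <=
  delta i / A * (Gamma b * g j i).

(** If c times the convolution over the i-th interval is bounded by a multiple of
[delta i * g j i] with [delta i] independent of j, then summing over i gives the
convolution up to [t j], and summing over j against p removes g. *)
Lemma kernel_sum_delta :
  c * \sum_(1 <= j < n) compl g n j * (t j `^ (A - alpha) / Gamma (A + b)) <=
  (\sum_(1 <= i < n) delta i) / Gamma (A + 1).
Proof.
have b0 : 0 < b by rewrite subr_gt0.
have GA := Gamma_gt0 A0; have Gb := Gamma_gt0 b0.
have H j : (1 <= j < n)%N -> c * (t j `^ (A - alpha) / Gamma (A + b)) <=
    \sum_(1 <= i < j.+1) g j i * (delta i / Gamma (A + 1)).
  move=> /andP[j1 jn].
  have jN : (j <= N)%N by rewrite (leq_trans (ltnW jn)).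
  have tj0 : 0 < t j by apply: mesh_gt0; rewrite j1.
  have E : \int[mu]_(s in `]0, t j[) (pker A s * pker b (t j - s)) =
      t j `^ (A + b - 1) * (Gamma A * Gamma b / Gamma (A + b)).
    by rewrite /Rintegral integral_conv.
  rewrite (Rintegral_mesh jN (integrable_conv A0 b0 tj0 (lexx _) (lexx _))) in E.
  rewrite -(ler_pM2l (mulr_gt0 GA Gb)).
  have -> : Gamma A * Gamma b * (c * (t j `^ (A - alpha) / Gamma (A + b))) =
      c * (t j `^ (A + b - 1) * (Gamma A * Gamma b / Gamma (A + b))).
    rewrite (_ : A + b - 1 = A - alpha); last by rewrite /b; ring.
    ring.
  rewrite -E !big_distrr/=; apply: ler_sum_nat => i /andP[i1 ij].
  apply: le_trans (delta_ge _ jn) _; first by rewrite i1.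
  rewrite GammaS// le_eqVlt; apply/orP; left; apply/eqP.
  field; rewrite ?gt_eqF//.
have GA1 : 0 < Gamma (A + 1) by rewrite Gamma_gt0 ?addr_gt0.
have w0 j : (1 <= j < n)%N -> 0 <= delta j / Gamma (A + 1).
  by move=> j1n; exact: (divr_ge0 (delta_ge0 j1n) (ltW GA1)).
rewrite big_distrl/=.
apply: le_trans (sum_compl_le g_gt0 g_homo nN w0).
rewrite big_distrr/=; apply: ler_sum_nat => j j1n.
rewrite mulrCA; apply: ler_wpM2l; last exact: H.
case/andP: j1n => j1 jn.
by apply: (compl_ge0 g_gt0 g_homo) => //; rewrite j1 ltnW.
Qed.

End delta.

Lemma sum_diff (u : nat -> R) n : \sum_(1 <= i < n.+1) (u i - u i.-1) = u n - u 0%N.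
Proof. by rewrite -telescope_sumr// big_add1. Qed.

(** [delta i] is the increment of t^A over the i-th interval if A <= 1, and over
the next one otherwise; either way the increments telescope below [t n ^ A]. *)
Lemma kernel_sum (A : R) n : 0 < A -> (1 <= n <= N)%N ->
  c * \sum_(1 <= j < n) compl g n j * (t j `^ (A - alpha) / Gamma (A + b)) <=
  t n `^ A / Gamma (A + 1).
Proof.
move=> A0 /andP[n1 nN].
have b0 : 0 < b by rewrite subr_gt0.
have GA1 : 0 < Gamma (A + 1) by rewrite Gamma_gt0 ?addr_gt0.
have homoA (x y : R) : 0 <= x -> x <= y -> x `^ A <= y `^ A.
  by move=> x0 xy; rewrite ge0_ler_powR ?nnegrE//; lra.
case: n n1 nN => // n _ nN.
have W i j : (1 <= i <= j)%N -> (j < n.+1)%N -> [/\ 0 <= t i.-1, t i.-1 < t i & t i <= t j].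
  move=> /andP[i1 ij] jn; have jN : (j <= N)%N by rewrite (leq_trans _ nN)// ltnW.
  have iN : (i <= N)%N by rewrite (leq_trans ij).
  by rewrite mesh_ge0 ?(leq_trans (leq_pred _))// t_incr ?i1// mesh_le.
have gW i j : (1 <= i <= j)%N -> (j < n.+1)%N ->
    c * (((t j - t i.-1) `^ b - (t j - t i) `^ b) / b) <= Gamma b * (step t i * g j i).
  by move=> ij jn; apply: g_ge => //; rewrite (leq_trans _ nN)// ltnW.
have [A1|A1] := leP A 1.
  apply: le_trans (@kernel_sum_delta A (fun i => t i `^ A - t i.-1 `^ A) n.+1 A0 nN _ _) _.
  - move=> i /andP[i1 i_n]; rewrite subr_ge0.
    have [h1 h2 _] : [/\ 0 <= t i.-1, t i.-1 < t i & t i <= t i].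
      by apply: W; rewrite ?i1 ?leqnn.
    by rewrite homoA// ltW.
  - move=> i j ij jn; have [h1 h2 h3] := W _ _ ij jn.
    have st0 : 0 < step t i by rewrite /step subr_gt0.
    rewrite -(ler_pM2l st0) mulrCA.
    have H := conv_piece_decreasing A0 A1 b0 (_ : b <= 1) h1 h2 h3.
    apply: (le_trans (ler_wpM2l c0 (H _))); first by rewrite gerBl ltW.
    rewrite mulrCA [leRHS]mulrCA.
    apply: ler_wpM2l; last first.
      by rewrite (le_trans (gW _ _ ij jn))// le_eqVlt; apply/orP; left; apply/eqP; ring.
    by rewrite divr_ge0 ?subr_ge0 ?homoA ?(ltW h2)// ltW.
  - rewrite ler_pM2r ?invr_gt0// sum_diff t0 powR0 ?gt_eqF// subr0.
    apply: homoA; first by rewrite mesh_ge0// ltnW.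
    by rewrite mesh_le.
apply: le_trans (@kernel_sum_delta A (fun i => t i.+1 `^ A - t i `^ A) n.+1 A0 nN _ _) _.
- move=> i /andP[i1 i_n]; rewrite subr_ge0 homoA ?mesh_ge0 ?mesh_le//.
  + by rewrite (leq_trans (ltnW i_n)).
  + by rewrite (leq_trans i_n).
- move=> i j ij jn; have [h1 h2 h3] := W _ _ ij jn.
  have H := conv_piece_increasing (ltW A1) b0 h1 h2 h3.
  apply: (le_trans (ler_wpM2l c0 H)).
  have iN : (i < N)%N.
    by case/andP: ij => _ ij; rewrite (leq_ltn_trans ij)// (leq_trans _ nN).
  have i1 : (1 <= i)%N by case/andP: ij.
  have gji : 0 < g j i by apply: g_gt0 => //; rewrite (leq_trans _ nN)// ltnW.
  have C := @powR_chord_ge _ A (t i) (t i.+1) (step t i) (ltW A1) _ _ _.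
  rewrite mulrCA.
  apply: (@le_trans _ _ (t i `^ (A - 1) * (Gamma b * (step t i * g j i)))).
    by rewrite ler_wpM2l ?powR_ge0 ?gW.
  rewrite (_ : t i `^ (A - 1) * (Gamma b * (step t i * g j i)) =
    (A * (t i `^ (A - 1) * step t i)) / A * (Gamma b * g j i)); last first.
    by field; rewrite gt_eqF.
  rewrite ler_pM2r; last by rewrite mulr_gt0// Gamma_gt0.
  rewrite ler_pM2r ?invr_gt0//; apply: C.
  + by apply: le_lt_trans h2.
  + by apply: (t_incr (n := i.+1)); rewrite iN.
  + by rewrite -[leRHS]/(step t i.+1) step_homo// i1.
rewrite ler_pM2r ?invr_gt0//.
rewrite (telescope_sumr (fun i => t i `^ A))// lerBlDr lerDl powR_ge0//.
Qed.

End kernel_sum.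

(** * Moments of a monotone function on an interval *)

Section moments.
Context {R : realType}.
Notation mu := (@lebesgue_measure R).
Variables (x y : R) (w : R -> R).
Hypothesis xy : x < y.
Hypothesis wc : forall z, x <= z <= y -> {for z, continuous w}.
Hypothesis wh : forall u v, x <= u -> u <= v -> v <= y -> w u <= w v.

Definition moment0 : R := \int[mu]_(s in `[x, y]) w s.
(** The moment about the midpoint: the constant part of w does not contribute to
it, so it measures the growth of w. *)
Definition moment1 : R := \int[mu]_(s in `[x, y]) (w s * (s - (x + y) / 2)).

Let D := `[x, y]%classic : set (measurableTypeR R).
Let mD : measurable D. Proof. exact: measurable_itv. Qed.

Lemma integrable_seg (h : R -> R) : (forall z, x <= z <= y -> {for z, continuous h}) ->
  mu.-integrable D (EFin \o h).
Proof.
move=> hc; apply: continuous_compact_integrable; first exact: segment_compact.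
by apply: continuous_in_subspaceT => z; rewrite inE/= ?in_itv/=; exact: hc.
Qed.

Lemma Rintegral_seg_cst (k : R) : \int[mu]_(s in D) k = k * (y - x).
Proof.
rewrite Rintegral_cst//; congr (_ * _).
by have := @lebesgue_measure_itv R `[x, y]; rewrite /= lte_fin xy => ->.
Qed.

Let mid : R := (x + y) / 2.

Lemma continuous_lin (k z : R) : {for z, continuous (fun s : R => s - k)}.
Proof. by apply: cvgB; [exact: cvg_id|exact: cvg_cst]. Qed.

Let clin z : {for z, continuous (fun s : R => s - mid)}.
Proof. exact: continuous_lin. Qed.

Lemma Rintegral_seg_mid : \int[mu]_(s in D) (s - mid) = 0.
Proof.
rewrite /Rintegral (@continuous_FTC2 _ _ (fun s => (s - mid) * (s - mid) / 2))//.
- by rewrite -EFinB/= /mid; field.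
- by apply: continuous_in_subspaceT => z _; exact: clin.
- have cF z : {for z, continuous (fun s : R => (s - mid) * (s - mid) / 2)}.
    apply: cvgM; last exact: cvg_cst.
    by apply: cvgM; exact: clin.
  split.
  + by move=> z _; apply: derivableM.
  + by apply: cvg_at_right_filter; exact: cF.
  + by apply: cvg_at_left_filter; exact: cF.
- move=> z _; rewrite derive1E.
  by rewrite derive_val !scaler0 add0r subr0 /GRing.scale/=; field.
Qed.

Let cwl z : x <= z <= y -> {for z, continuous (fun s => w s * (s - mid))}.
Proof. by move=> h; apply: cvgM; [exact: wc|exact: clin]. Qed.

Let iw : mu.-integrable D (EFin \o w).
Proof. exact: integrable_seg. Qed.

Let iwl : mu.-integrable D (EFin \o (fun s => w s * (s - mid))).
Proof. exact: integrable_seg. Qed.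

Let il : mu.-integrable D (EFin \o (fun s => s - mid)).
Proof. by apply: integrable_seg => z _; exact: clin. Qed.

Let ic (k : R) : mu.-integrable D (EFin \o (fun=> k)).
Proof. by apply: integrable_seg => z _; exact: cvg_cst. Qed.

Let iZ (k : R) (h : R -> R) : mu.-integrable D (EFin \o h) ->
  mu.-integrable D (EFin \o (fun s => k * h s)).
Proof. by move=> hi; exact: (@integrableZl _ _ _ mu D mD k (EFin \o h) hi). Qed.

Let iD (h1 h2 : R -> R) : mu.-integrable D (EFin \o h1) -> mu.-integrable D (EFin \o h2) ->
  mu.-integrable D (EFin \o (fun s => h1 s + h2 s)).
Proof. by move=> h1i h2i; exact: (@integrableD _ _ _ mu D mD (EFin \o h1) (EFin \o h2)). Qed.

Let Rint_aff (k l : R) : \int[mu]_(s in D) (k + l * (s - mid)) = k * (y - x).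
Proof.
rewrite (RintegralD mD (ic k) (iZ l il)) (RintegralZl _ mD il).
by rewrite Rintegral_seg_mid mulr0 addr0 Rintegral_seg_cst.
Qed.

Let iaff (k l : R) : mu.-integrable D (EFin \o (fun s => k + l * (s - mid))).
Proof. exact: (iD (ic k) (iZ l il)). Qed.

Lemma moment1_ge0 : 0 <= moment1.
Proof.
rewrite -[leLHS](mul0r (y - x)) -(Rint_aff 0 (w mid)).
apply: (le_Rintegral mD) => //.
move=> s; rewrite /D/= in_itv/= => /andP[xs sy]; rewrite add0r.
have [h1 h2] : x <= mid /\ mid <= y by rewrite /mid; move: xy => h; split; lra.
have [sm|ms] := leP s mid.
  by rewrite ler_wnM2r ?subr_le0//; apply: wh.
by rewrite ler_wpM2r ?subr_ge0 ?(ltW ms)//; apply: wh => //; exact: ltW.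
Qed.

Let weightE (d : R) : moment0 - d * moment1 =
  \int[mu]_(s in D) (w s + (- d) * (w s * (s - mid))).
Proof. by rewrite (RintegralD mD iw (iZ _ iwl)) (RintegralZl _ mD iwl) mulNr. Qed.

(** The right-hand side is the integral of w against the weight
[1 - d * (s - (x + y) / 2)], which is nonnegative and of total mass y - x. *)
Lemma moment_sub_ge (d : R) : 0 <= d -> d * (y - x) <= 1 ->
  (y - x) * w x <= moment0 - d * moment1.
Proof.
move=> d0 dxy; rewrite weightE mulrC -(Rint_aff (w x) (w x * (- d))).
apply: (le_Rintegral mD) => //; first exact: (iD iw (iZ _ iwl)).
move=> s; rewrite /D/= in_itv/= => /andP[xs sy].
have -> : w x + w x * - d * (s - mid) = w x * (1 - d * (s - mid)) by ring.
have -> : w s + - d * (w s * (s - mid)) = w s * (1 - d * (s - mid)) by ring.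
rewrite ler_wpM2r//; last exact: wh.
rewrite subr_ge0 (le_trans _ dxy)// ler_wpM2l// /mid; move: xy => h; lra.
Qed.

(** The same weight is at least 1/2 throughout the interval. *)
Lemma moment_sub_ge_half (d : R) : 0 <= d -> d * (y - x) <= 1 -> 0 <= w x ->
  moment0 / 2 <= moment0 - d * moment1.
Proof.
move=> d0 dxy wx; rewrite weightE mulrC -(RintegralZl _ mD iw).
apply: (le_Rintegral mD) => //; [exact: iZ|exact: (iD iw (iZ _ iwl))|].
move=> s; rewrite /D/= in_itv/= => /andP[xs sy].
have -> : w s + - d * (w s * (s - mid)) = (1 - d * (s - mid)) * w s by ring.
have ws : 0 <= w s by apply: le_trans wx _; apply: wh.
rewrite ler_wpM2r//.
have : d * (s - mid) <= d * ((y - x) / 2) by rewrite ler_wpM2l// /mid; lra.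
lra.
Qed.

(** Subtract the value of w at the midpoint, which does not change the moment,
and bound (s - (x + y) / 2)^2 by ((y - x) / 2)^2. *)
Lemma moment1_le (k : R) : 0 <= k ->
  (forall u v, x <= u -> u <= v -> v <= y -> w v - w u <= k * (v - u)) ->
  moment1 <= k * (y - x) ^+ 3 / 4.
Proof.
move=> k0 slope.
have [h1 h2] : x <= mid /\ mid <= y by rewrite /mid; move: xy => h; split; lra.
have -> : k * (y - x) ^+ 3 / 4 = (k * (y - x) ^+ 2 / 4) * (y - x) by ring.
rewrite -(Rint_aff (k * (y - x) ^+ 2 / 4) (w mid)).
apply: (le_Rintegral mD) => //.
move=> s; rewrite /D/= in_itv/= => /andP[xs sy]; rewrite -/mid -lerBlDr -mulrBl.
apply: (@le_trans _ _ (k * (s - mid) ^+ 2)).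
  have [sm|/ltW ms] := leP s mid.
    have H := slope _ _ xs sm h2.
    have -> : (w s - w mid) * (s - mid) = (w mid - w s) * (mid - s) by ring.
    have -> : k * (s - mid) ^+ 2 = (k * (mid - s)) * (mid - s) by ring.
    by rewrite ler_wpM2r ?subr_ge0.
  rewrite expr2 mulrA ler_wpM2r ?subr_ge0//; exact: slope.
rewrite -mulrA ler_wpM2l//.
have [e1 e2] : - ((y - x) / 2) <= s - mid /\ s - mid <= (y - x) / 2.
  by rewrite /mid; split; lra.
have -> : (y - x) ^+ 2 / 4 = ((y - x) / 2) ^+ 2 by field.
rewrite -subr_ge0 subr_sqr mulr_ge0//; lra.
Qed.

Lemma moment0_le (k : R) :
  (forall u, x <= u -> u <= y -> k * (y - u) <= w y - w u) ->
  moment0 <= (y - x) * w y - k * (y - x) ^+ 2 / 2.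
Proof.
move=> slope.
have -> : (y - x) * w y - k * (y - x) ^+ 2 / 2 = (w y - k * (y - mid)) * (y - x).
  by rewrite /mid; field.
rewrite -(Rint_aff _ k); apply: (le_Rintegral mD) => //.
move=> s; rewrite /D/= in_itv/= => /andP[xs sy].
by have := slope _ xs sy; lra.
Qed.

Lemma moment0_ge (h : R -> R) : (forall z, x <= z <= y -> {for z, continuous h}) ->
  (forall z, x <= z <= y -> h z <= w z) -> \int[mu]_(s in D) h s <= moment0.
Proof.
move=> hc hw; apply: (le_Rintegral mD) => //; first exact: integrable_seg.
Qed.

End moments.

(** * Coefficients of a single order *)

Section single_order.
Context {R : realType}.
Notation mu := (@lebesgue_measure R).
Variables (N : nat) (t sigma : nat -> R) (al : R) (n : nat).
Hypothesis al0 : 0 < al.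
Hypothesis al1 : al < 1.
Hypothesis t_incr : forall k, (1 <= k <= N)%N -> t k.-1 < t k.
Hypothesis step_homo : forall k, (1 <= k < N)%N -> step t k <= step t k.+1.
Hypothesis n1N : (1 <= n <= N)%N.
Hypothesis sigma_n : 0 <= sigma n < 1.

Let th := shifted sigma t n.
Let w (s : R) : R := (th - s) `^ (- al).

Let thE : th = t n.-1 + (1 - sigma n) * step t n.
Proof. rewrite /th /shifted /step; ring. Qed.

Let le_th j : (j < n)%N -> t j < th.
Proof.
move=> jn; rewrite thE.
have h1 : t j <= t n.-1.
  have nN : (n.-1 <= N)%N by case/andP: n1N => _ /(leq_trans (leq_pred _)).
  have jn1 : (j <= n.-1)%N by rewrite -ltnS prednK//; case/andP: n1N.
  elim: n.-1 jn1 nN => [|k IH]; first by rewrite leqn0 => /eqP->.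
  rewrite leq_eqVlt => /predU1P[->//|]; rewrite ltnS => jk kN.
  by apply: (le_trans (IH jk (ltnW kN))); apply/ltW/(t_incr (k := k.+1)); rewrite kN.
apply: (le_lt_trans h1); rewrite ltrDl mulr_gt0//.
  by rewrite subr_gt0; case/andP: sigma_n.
by rewrite subr_gt0 t_incr.
Qed.

Let wcont z : z < th -> {for z, continuous w}.
Proof.
move=> zt; apply: (@continuous_comp _ _ _ (fun s => th - s) (fun u => u `^ (- al))).
  by apply: cvgB; [exact: cvg_cst|exact: cvg_id].
by apply: powR_continuous; rewrite subr_gt0.
Qed.

Let wle u v : u <= v -> v < th -> w u <= w v.
Proof. by move=> uv vt; apply: powRN_nonincr; rewrite ?(ltW al0)//; lra. Qed.

Section piece.
Variable j : nat.
Hypothesis j1n : (1 <= j < n)%N.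

Let jn : (j < n)%N. Proof. by case/andP: j1n. Qed.
Let j1 : (1 <= j)%N. Proof. by case/andP: j1n. Qed.
Let jltN : (j < N)%N. Proof. by rewrite (leq_trans jn)//; case/andP: n1N. Qed.

Let xy : t j.-1 < t j. Proof. by apply: t_incr; rewrite j1 ltnW. Qed.

Let wc z : t j.-1 <= z <= t j -> {for z, continuous w}.
Proof. by move=> /andP[_ zj]; apply: wcont; apply: (le_lt_trans zj); exact: le_th. Qed.

Let wh u v : t j.-1 <= u -> u <= v -> v <= t j -> w u <= w v.
Proof. by move=> _ uv vj; apply: wle => //; apply: (le_lt_trans vj); exact: le_th. Qed.

Let m0 := moment0 (t j.-1) (t j) w.
Let m1 := moment1 (t j.-1) (t j) w.
Let d := 2 / (t j.+1 - t j.-1).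

Lemma coef_aE : coef_a t sigma al n j = (Gamma (1 - al))^-1 * m0.
Proof. by rewrite /coef_a (ltn_eqF jn). Qed.

Lemma coef_bE : coef_b t sigma al n j = (Gamma (1 - al))^-1 * (d * m1).
Proof. by rewrite /coef_b -/th invfM mulrCA -mulrA. Qed.

Lemma step_le_succ : step t j <= step t j.+1.
Proof. by apply: step_homo; rewrite j1. Qed.

Lemma piece_weight_ge0 : 0 <= d.
Proof.
have := step_le_succ; have := xy; rewrite /step /d => h1 h2.
by rewrite divr_ge0//; lra.
Qed.

(** The nodes t_(j+1) and t_(j-1) are at least two j-th steps apart because the
steps do not decrease. *)
Lemma piece_weight_le : d * (t j - t j.-1) <= 1.
Proof.
have := step_le_succ; have := xy; rewrite /step /d /= => h1 h2.
rewrite mulrAC ler_pdivrMr; lra.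
Qed.

Lemma piece_moment1_ge0 : 0 <= m1. Proof. exact: moment1_ge0. Qed.

Lemma piece_ge_left : step t j * w (t j.-1) <= m0 - d * m1.
Proof. exact: (moment_sub_ge xy wc wh piece_weight_ge0 piece_weight_le). Qed.

Lemma piece_ge_half : m0 / 2 <= m0 - d * m1.
Proof.
apply: (moment_sub_ge_half wc wh piece_weight_ge0 piece_weight_le).
by rewrite /w powR_ge0.
Qed.

Lemma piece_moment1_le : m1 <= (al * (th - t j) `^ (- al - 1)) * step t j ^+ 3 / 4.
Proof.
have tj := le_th jn.
apply: (moment1_le xy wc); first by rewrite mulr_ge0 ?powR_ge0// ltW.
move=> u v xu uv vy; rewrite (_ : v - u = (th - u) - (th - v)); last by ring.
by apply: powRN_slope_le => //; rewrite ?subr_gt0//; lra.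
Qed.

Lemma piece_moment0_le : m0 <= step t j * w (t j) - (al * (th - t j.-1) `^ (- al - 1)) * step t j ^+ 2 / 2.
Proof.
have tj := le_th jn.
apply: (moment0_le xy wc) => u xu uy.
rewrite (_ : t j - u = (th - u) - (th - t j)); last by ring.
by apply: powRN_slope_ge => //; rewrite ?subr_gt0//; lra.
Qed.

(** Replacing the shifted node by [t n] makes the kernel smaller. *)
Lemma piece_moment0_ge_kernel : ((t n - t j.-1) `^ (1 - al) - (t n - t j) `^ (1 - al)) / (1 - al) <= m0.
Proof.
have tj := le_th jn.
have thn : th <= t n.
  have : t n.-1 < t n := t_incr n1N.
  case/andP: sigma_n => s0 s1; rewrite thE /step => tn.
  have : (1 - sigma n) * (t n - t n.-1) <= 1 * (t n - t n.-1).
    by rewrite ler_wpM2r//; lra.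
  lra.
have b0 : 0 < 1 - al by rewrite subr_gt0.
have tjn : t j <= t n by lra.
have := integral_pkerB b0 xy tjn.
rewrite -(integral_itv_bndoo true false); last first.
  by apply/measurable_EFinP; apply: measurable_funTS; exact: measurable_pkerB.
move=> E.
have -> : ((t n - t j.-1) `^ (1 - al) - (t n - t j) `^ (1 - al)) / (1 - al) =
    \int[mu]_(s in `[t j.-1, t j]) (pker (1 - al) (t n - s)).
  by rewrite /Rintegral E.
have -> : \int[mu]_(s in `[t j.-1, t j]) (pker (1 - al) (t n - s)) =
  \int[mu]_(s in `[t j.-1, t j]) ((t n - s) `^ (- al)).
  apply: eq_Rintegral => s; rewrite inE/= ?in_itv/= => /andP[_ sj].
  rewrite pker_gt0E; last by lra.
  by congr (_ `^ _); ring.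
apply: (moment0_ge wc) => z /andP[xz zy].
  apply: (@continuous_comp _ _ _ (fun s => t n - s) (fun u => u `^ (- al))).
    by apply: cvgB; [exact: cvg_cst|exact: cvg_id].
  by apply: powR_continuous; lra.
by apply: powRN_nonincr; rewrite ?(ltW al0)//; lra.
Qed.

End piece.

Lemma coef_a_diagE : coef_a t sigma al n n = (Gamma (1 - al))^-1 *
  (((1 - sigma n) * step t n) `^ (1 - al) / (1 - al)).
Proof.
have b0 : 0 < 1 - al by rewrite subr_gt0.
have n1 : (n.-1 < n)%N by rewrite prednK//; case/andP: n1N.
have tj := le_th n1.
rewrite /coef_a eqxx -/th; congr (_ * _).
have := integral_pkerB b0 tj (lexx th).
rewrite subrr powR0 ?gt_eqF// subr0.
rewrite -(integral_itv_bndoo true false); last first.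
  by apply/measurable_EFinP; apply: measurable_funTS; exact: measurable_pkerB.
rewrite (_ : th - t n.-1 = (1 - sigma n) * step t n); last by rewrite thE; ring.
move=> E; rewrite -[RHS]/(fine (_%:E)) -E /Rintegral; congr fine.
apply: eq_integral => s; rewrite inE/= ?in_itv/= => /andP[_].
rewrite le_eqVlt => /predU1P[->|sj].
  (* at the singular endpoint both integrands are 0 by convention *)
  by rewrite subrr pker_le0E// powR0// oppr_eq0 gt_eqF.
rewrite pker_gt0E ?subr_gt0//; congr ((_ `^ _)%:E); ring.
Qed.

(** The slope of w on the i-th interval is at most its slope at [t i], by
convexity; this is the slope that also bounds the gain of w on the next
interval from below in [piece_moment0_le]. *)
Lemma coef_b_le i : (1 <= i)%N -> (i.+1 < n)%N ->
  Gamma (1 - al) * coef_b t sigma al n i <=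
  al * (th - t i) `^ (- al - 1) * step t i.+1 ^+ 2 / 4.
Proof.
move=> i1 in_; have i1n : (1 <= i < n)%N by rewrite i1 ltnW.
have nN : (n <= N)%N by case/andP: n1N.
have G0 : 0 < Gamma (1 - al) by rewrite Gamma_gt0 ?subr_gt0.
rewrite coef_bE mulVKf ?gt_eqF//.
have Hf := piece_moment1_le i1n; have d0 := piece_weight_ge0 i1n.
have gi : step t i <= step t i.+1 by apply: (step_le_succ i1n).
have si : 0 <= step t i.
  by rewrite subr_ge0 ltW// t_incr// i1 (leq_trans (ltnW (ltnW in_))).
have dl := piece_weight_le i1n; rewrite -/(step t i) in dl.
set kk := al * _; rewrite -/kk in Hf.
have k0 : 0 <= kk by rewrite mulr_ge0 ?powR_ge0 ?ltW.
apply: le_trans (ler_wpM2l d0 Hf) _.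
have -> : 2 / (t i.+1 - t i.-1) * (kk * step t i ^+ 3 / 4) =
  (2 / (t i.+1 - t i.-1) * step t i) * (kk * step t i ^+ 2 / 4) by ring.
apply: (@le_trans _ _ (1 * (kk * step t i ^+ 2 / 4))).
  by apply: ler_wpM2r => //; apply: divr_ge0 => //; exact: (mulr_ge0 k0 (sqr_ge0 _)).
rewrite mul1r ler_pM2r ?invr_gt0// ler_wpM2l//.
by apply: lerXn2r => //; rewrite nnegrE// (le_trans si).
Qed.

(** The mean of w over the j-th interval falls short of w(t_j) by at least half a
step times the slope at [t j.-1], while the moment of the preceding interval
adds at most a quarter of that step times the same slope. *)
Lemma coef_g1_le_right j : (1 <= j < n)%N ->
  Gamma (1 - al) * coef_g1 t sigma al n j <= w (t j).
Proof.
move=> /[dup] j1n /andP[j1 jn].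
have jN : (j < N)%N by rewrite (leq_trans jn)//; case/andP: n1N.
have tj := le_th jn.
have G0 : 0 < Gamma (1 - al) by rewrite Gamma_gt0 ?subr_gt0.
have st0 : 0 < step t j by rewrite subr_gt0 t_incr ?j1// ltnW.
have zle := piece_moment0_le j1n; have fj0 := piece_moment1_ge0 j1n; have dj0 := piece_weight_ge0 j1n.
rewrite /coef_g1 jn (coef_aE j1n) (coef_bE j).
set k := al * (th - t j.-1) `^ (- al - 1) in zle.
set B := if _ then _ else _.
have k0 : 0 <= k by rewrite mulr_ge0 ?powR_ge0 ?ltW.
have HB : Gamma (1 - al) * B <= k * step t j ^+ 2 / 2.
  rewrite /B; case: ifPn => [j2|_]; last first.
    by rewrite mulr0; apply: divr_ge0 => //; exact: (mulr_ge0 k0 (sqr_ge0 _)).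
  have jp : (0 < j.-1)%N by rewrite -ltnS prednK.
  have := @coef_b_le j.-1; rewrite prednK// => /(_ jp jn) H.
  apply: (le_trans H); rewrite -/k; apply: ler_wpM2l; last by lra.
  exact: (mulr_ge0 k0 (sqr_ge0 _)).
rewrite mulrCA ler_pdivrMl//.
rewrite mulrBr mulrDr !mulrA mulfV ?gt_eqF// !mul1r.
have h : 0 <= 2 / (t j.+1 - t j.-1) * moment1 (t j.-1) (t j) w by rewrite mulr_ge0.
lra.
Qed.

Lemma coef_b_ge0 j : (1 <= j < n)%N -> 0 <= Gamma (1 - al) * coef_b t sigma al n j.
Proof.
move=> j1n; have G0 : 0 < Gamma (1 - al) by rewrite Gamma_gt0 ?subr_gt0.
rewrite coef_bE mulVKf ?gt_eqF// mulr_ge0//.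
- exact: piece_weight_ge0.
- exact: piece_moment1_ge0.
Qed.

(** The moment of the preceding interval enters with a positive sign and may be
dropped. *)
Lemma coef_g1_ge j C : (1 <= j < n)%N ->
  C <= moment0 (t j.-1) (t j) w - 2 / (t j.+1 - t j.-1) * moment1 (t j.-1) (t j) w ->
  C <= step t j * (Gamma (1 - al) * coef_g1 t sigma al n j).
Proof.
move=> /[dup] j1n /andP[j1 jn] HC.
have jN : (j < N)%N by rewrite (leq_trans jn)//; case/andP: n1N.
have G0 : 0 < Gamma (1 - al) by rewrite Gamma_gt0 ?subr_gt0.
have st0 : 0 < step t j by rewrite subr_gt0 t_incr ?j1// ltnW.
rewrite /coef_g1 jn (coef_aE j1n) (coef_bE j).
set B := if _ then _ else _.
have HB : 0 <= Gamma (1 - al) * B.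
  rewrite /B; case: ifPn => [j2|_]; last by rewrite mulr0.
  apply: coef_b_ge0; apply/andP; split; first by rewrite -ltnS prednK.
  exact: leq_ltn_trans (leq_pred _) jn.
rewrite mulrCA mulVKf ?gt_eqF//.
rewrite mulrBr mulrDr !mulrA mulfV ?gt_eqF// !mul1r.
apply: (le_trans HC); rewrite -!mulrA; lra.
Qed.

Lemma coef_g1_ge_left j : (1 <= j < n)%N ->
  w (t j.-1) <= Gamma (1 - al) * coef_g1 t sigma al n j.
Proof.
move=> /[dup] j1n /andP[j1 jn].
have jN : (j < N)%N by rewrite (leq_trans jn)//; case/andP: n1N.
have st0 : 0 < step t j by rewrite subr_gt0 t_incr ?j1// ltnW.
by rewrite -(ler_pM2l st0); apply: coef_g1_ge => //; exact: piece_ge_left.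
Qed.

Lemma coef_g1_ge_kernel j : (1 <= j < n)%N ->
  ((t n - t j.-1) `^ (1 - al) - (t n - t j) `^ (1 - al)) / (1 - al) / 2 <=
  step t j * (Gamma (1 - al) * coef_g1 t sigma al n j).
Proof.
move=> j1n; apply: coef_g1_ge => //; apply: le_trans (piece_ge_half j1n).
by rewrite ler_pM2r ?invr_gt0//; exact: piece_moment0_ge_kernel.
Qed.

Lemma coef_g1_diag_ge : ((1 - sigma n) * step t n) `^ (1 - al) / (1 - al) <=
  step t n * (Gamma (1 - al) * coef_g1 t sigma al n n).
Proof.
have n1 : (1 <= n)%N by case/andP: n1N.
have G0 : 0 < Gamma (1 - al) by rewrite Gamma_gt0 ?subr_gt0.
have st0 : 0 < step t n by rewrite subr_gt0 t_incr.
rewrite /coef_g1 ltnn subr0 coef_a_diagE.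
set B := if _ then _ else _.
have HB : 0 <= Gamma (1 - al) * B.
  rewrite /B; case: ifPn => [j2|_]; last by rewrite mulr0.
  by apply: coef_b_ge0; apply/andP; split; [rewrite -ltnS prednK|rewrite prednK].
rewrite mulrCA mulVKf ?gt_eqF//.
rewrite [leRHS]mulrDr mulVKf ?gt_eqF//; lra.
Qed.

End single_order.

(** The right-hand side is the factor in [diag_balance]; the left-hand side is
twice the factor in the equation for the shift once Gamma(3 - a) is replaced by
(2 - a) Gamma(2 - a). Their difference is a (2 - a - s) / (2 - a). *)
(** * Coefficients of the multi-term derivative *)

Lemma shift_factor_le (R : realType) (a s : R) : 0 < a -> a < 1 -> s <= 1 ->
  (s - (1 - a / 2)) / (2 - a) * 2 <= s - 1 + a.
Proof.
move=> a0 a1 s1; have h : 0 < 2 - a by lra.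
rewrite mulrAC ler_pdivrMr//.
rewrite -subr_ge0.
have -> : (s - 1 + a) * (2 - a) - (s - (1 - a / 2)) * 2 = a * (2 - a - s) by field.
by rewrite mulr_ge0 ?(ltW a0)//; lra.
Qed.

Section multiterm.
Context {R : realType}.
Variables (m N : nat) (alpha mu t sigma : nat -> R).
Hypothesis m_gt0 : (0 < m)%N.
Hypothesis mu_gt0 : forall s : nat, (1 <= s <= m)%N -> 0 < mu s.
Hypothesis alpha01 : forall s : nat, (1 <= s <= m)%N -> 0 < alpha s < 1.
Hypothesis t_incr : forall k, (1 <= k <= N)%N -> t k.-1 < t k.
Hypothesis step_homo : forall k, (1 <= k < N)%N -> step t k <= step t k.+1.
Hypothesis sigma_lt_half : forall n, (1 <= n <= N)%N -> 0 <= sigma n <= 1 / 2.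
Hypothesis sigma_root : forall n, (1 <= n <= N)%N ->
  shift_fun m alpha mu t n (1 - sigma n) = 0.

Local Notation g := (coef_g m alpha mu t sigma).

Let sigma1 n : (1 <= n <= N)%N -> 0 <= sigma n < 1.
Proof. by move=> /sigma_lt_half/andP[h1 h2]; rewrite h1/=; lra. Qed.

Let step_gt0 n : (1 <= n <= N)%N -> 0 < step t n.
Proof. by move=> h; rewrite subr_gt0 t_incr. Qed.

Let Gamma_1sub_gt0 s : (1 <= s <= m)%N -> 0 < Gamma (1 - alpha s).
Proof. by move=> /alpha01/andP[h1 h2]; apply: Gamma_gt0; rewrite subr_gt0. Qed.

Lemma coef_g1_gt0 s n j : (1 <= s <= m)%N -> (1 <= j <= n)%N -> (n <= N)%N ->
  0 < coef_g1 t sigma (alpha s) n j.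
Proof.
move=> sm /andP[j1 jn] nN; have n1N : (1 <= n <= N)%N by rewrite (leq_trans j1).
have /andP[a0 a1] := alpha01 sm; have G := Gamma_1sub_gt0 sm.
have tau0 := step_gt0 n1N.
have q0 : 0 < (1 - sigma n) * step t n.
  by apply: mulr_gt0 => //; have /andP[_ h] := sigma1 n1N; rewrite subr_gt0.
rewrite -(pmulr_rgt0 _ G).
move: jn; rewrite leq_eqVlt => /predU1P[->|jn].
  rewrite -(pmulr_rgt0 _ tau0).
  apply: lt_le_trans (coef_g1_diag_ge a0 a1 t_incr step_homo n1N (sigma1 n1N)).
  by rewrite divr_gt0 ?powR_gt0// subr_gt0.
have j1n : (1 <= j < n)%N by rewrite j1.
have := coef_g1_ge_left a0 a1 t_incr step_homo n1N (sigma1 n1N) j1n.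
apply: lt_le_trans; apply: powR_gt0; rewrite subr_gt0.
have h1 : t j.-1 <= t n.-1.
  have nn : (n.-1 <= N)%N by rewrite (leq_trans (leq_pred _)).
  apply: (mesh_le t_incr) => //.
  by rewrite -!subn1 leq_sub2r// ltnW.
apply: (le_lt_trans h1).
by rewrite (_ : shifted sigma t n = t n.-1 + (1 - sigma n) * step t n)
  ?ltrDl// /shifted /step; ring.
Qed.

(** Every single-order coefficient is positive, and there is at least one order
as 1 <= m. *)
Lemma coef_g_gt0 n j : (1 <= j <= n)%N -> (n <= N)%N -> 0 < g n j.
Proof.
move=> jn nN; rewrite /coef_g big_nat.
rewrite -(big_nat _ _ 1 m.+1 (fun s => mu s * coef_g1 t sigma (alpha s) n j)).
rewrite big_ltn//.
apply: ltr_pwDl; first by rewrite mulr_gt0 ?mu_gt0 ?coef_g1_gt0.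
rewrite big_nat sumr_ge0// => s /andP[s2 sm]; rewrite ltW//.
by rewrite mulr_gt0 ?mu_gt0 ?coef_g1_gt0// (ltnW s2).
Qed.

Lemma coef_g_ge_first n j : (1 <= j <= n)%N -> (n <= N)%N ->
  mu 1%N * coef_g1 t sigma (alpha 1%N) n j <= g n j.
Proof.
move=> jn nN; rewrite /coef_g big_ltn// lerDl big_nat sumr_ge0// => s /andP[s2 sm].
by rewrite ltW// mulr_gt0 ?mu_gt0 ?coef_g1_gt0// (ltnW s2).
Qed.

Lemma shifted_sub n : shifted sigma t n - t n.-1 = (1 - sigma n) * step t n.
Proof. by rewrite /shifted /step; ring. Qed.

(** Up to the common factor [z * tau ^+ 2], twice the equation defining the shift
is a sum with the same positive weights and, term by term, smaller factors
([shift_factor_le]). *)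
Lemma diag_balance n : (1 <= n <= N)%N ->
  0 <= \sum_(1 <= s < m.+1) mu s / Gamma (2 - alpha s)
     * ((1 - sigma n) * step t n) `^ (- alpha s) * (1 - sigma n - 1 + alpha s).
Proof.
move=> n1N; have root := sigma_root n1N.
have /andP[s0 s1] := sigma_lt_half n1N.
have tau0 := step_gt0 n1N.
set z := 1 - sigma n in root *; set tau := step t n in root tau0 *.
have z0 : 0 < z by rewrite /z; lra.
have z1 : z <= 1 by rewrite /z; lra.
have zt : 0 < z * tau ^+ 2 by rewrite mulr_gt0 ?exprn_gt0.
rewrite -(pmulr_rge0 _ zt).
apply: (@le_trans _ _ (2 * shift_fun m alpha mu t n z)); first by rewrite root mulr0.
rewrite /shift_fun !big_distrr/=; apply: ler_sum_nat => s /andP[s1' sm].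
have sm' : (1 <= s <= m)%N by rewrite s1'.
have /andP[a0 a1] := alpha01 sm'.
have m0 := mu_gt0 sm'.
have G2 : 0 < Gamma (2 - alpha s) by apply: Gamma_gt0; lra.
have G3 : Gamma (3 - alpha s) = (2 - alpha s) * Gamma (2 - alpha s).
  by rewrite -GammaS; [congr Gamma; ring|lra].
have P1 : z `^ (1 - alpha s) = z * z `^ (- alpha s) by rewrite powRDgt0// powRr1// ltW.
have P2 : tau `^ (2 - alpha s) = tau ^+ 2 * tau `^ (- alpha s).
  by rewrite powRDgt0// -powR_mulrn// ltW.
have P3 : (z * tau) `^ (- alpha s) = z `^ (- alpha s) * tau `^ (- alpha s).
  by rewrite powRM// ltW.
rewrite G3 -/tau P1 P2 P3.
have H := shift_factor_le a0 a1 z1.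
set G := Gamma _ in G2 *; set x := z `^ _; set y := tau `^ _.
have x0 : 0 < x by apply: powR_gt0.
have y0 : 0 < y by apply: powR_gt0.
have c0 : 0 <= z * tau ^+ 2 * (mu s / G * (x * y)).
  by rewrite mulr_ge0 ?(ltW zt)// mulr_ge0 ?divr_ge0 ?mulr_ge0// ltW.
have -> : 2 * (mu s / ((2 - alpha s) * G) * (z * x)
    * (z - (1 - alpha s / 2)) * (tau ^+ 2 * y)) =
  z * tau ^+ 2 * (mu s / G * (x * y)) * ((z - (1 - alpha s / 2)) / (2 - alpha s) * 2).
  by field; rewrite ?gt_eqF//; lra.
have -> : z * tau ^+ 2 * (mu s / G * (x * y) * (z - 1 + alpha s)) =
  z * tau ^+ 2 * (mu s / G * (x * y)) * (z - 1 + alpha s) by ring.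
exact: ler_wpM2l.
Qed.

(** Below the diagonal w(t_j) separates the two coefficients order by order. At
the diagonal it need not, and the differences from w(t_(n-1)) are summed over
all orders and compared with [diag_balance]. *)
Lemma coef_g_homo n j : (1 <= j < n)%N -> (n <= N)%N -> g n j <= g n j.+1.
Proof.
move=> /[dup] j1n /andP[j1 jn] nN.
have n1N : (1 <= n <= N)%N by rewrite (leq_trans j1 (ltnW jn)).
move: (jn); rewrite leq_eqVlt => /predU1P[jn1|jn1]; last first.
  rewrite /coef_g; apply: ler_sum_nat => s sm; rewrite ltnS in sm.
  have /andP[a0 a1] := alpha01 sm; have G := Gamma_1sub_gt0 sm.
  rewrite ler_pM2l ?mu_gt0// -(ler_pM2l G).
  have H1 := coef_g1_le_right a0 a1 t_incr step_homo n1N (sigma1 n1N) j1n.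
  have j1n' : (1 <= j.+1 < n)%N by [].
  have H2 := coef_g1_ge_left a0 a1 t_incr step_homo n1N (sigma1 n1N) j1n'.
  exact: le_trans H1 H2.
rewrite jn1 -subr_ge0 /coef_g -sumrB.
apply: (le_trans (diag_balance n1N)).
apply: ler_sum_nat => s sm; rewrite ltnS in sm.
have /andP[a0 a1] := alpha01 sm; have G := Gamma_1sub_gt0 sm.
have H1 := coef_g1_le_right a0 a1 t_incr step_homo n1N (sigma1 n1N) j1n.
have H2 := coef_g1_diag_ge a0 a1 t_incr step_homo n1N (sigma1 n1N).
have jE : t j = t n.-1 by rewrite -jn1.
rewrite jE shifted_sub in H1.
have tau0 := step_gt0 n1N.
have z0 : 0 < 1 - sigma n by have /andP[_ h] := sigma1 n1N; rewrite subr_gt0.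
set z := 1 - sigma n in z0 H1 H2 *; set tau := step t n in tau0 H1 H2 *.
have q0 : 0 < z * tau by rewrite mulr_gt0.
have G2 : Gamma (2 - alpha s) = (1 - alpha s) * Gamma (1 - alpha s).
  exact: Gamma_2sub.
have b0 : 0 < 1 - alpha s by rewrite subr_gt0.
rewrite powRDgt0// (powRr1 (ltW q0)) in H2.
rewrite G2.
set x := (z * tau) `^ _ in H1 H2 *; set G1 := Gamma _ in G H1 H2 *.
set A := coef_g1 _ _ _ n n in H2 *; set B := coef_g1 _ _ _ n j in H1 *.
have H2' : z * x / (1 - alpha s) <= G1 * A.
  rewrite -(ler_pM2l tau0); apply: le_trans H2.
  by rewrite le_eqVlt; apply/orP; left; apply/eqP; ring.
rewrite -mulrBr -!mulrA; apply: ler_wpM2l; first by rewrite ltW// mu_gt0.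
rewrite -(ler_pM2l G) mulrBr.
apply: (@le_trans _ _ (z * x / (1 - alpha s) - x)); last by lra.
by rewrite le_eqVlt; apply/orP; left; apply/eqP; field; rewrite ?gt_eqF.
Qed.

Let b : R := 1 - alpha 1%N.
Let one_m : (1 <= 1 <= m)%N. Proof. by rewrite m_gt0. Qed.

(** Only the first order is kept. Off the diagonal the factor 1/2 comes from
[moment_sub_ge_half]; on the diagonal it comes from 1 - sigma >= 1/2. *)
Lemma coef_g_kernel n j : (1 <= j <= n)%N -> (n <= N)%N ->
  mu 1%N / 2 * (((t n - t j.-1) `^ b - (t n - t j) `^ b) / b) <=
  Gamma b * (step t j * g n j).
Proof.
move=> /[dup] jn' /andP[j1 jn] nN.
have n1N : (1 <= n <= N)%N by rewrite (leq_trans j1).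
have j1N : (1 <= j <= N)%N by rewrite j1 (leq_trans jn).
have /andP[a0 a1] := alpha01 one_m; have G : 0 < Gamma b := Gamma_1sub_gt0 one_m.
have m0 := mu_gt0 one_m.
have b0 : 0 < b by rewrite subr_gt0.
suff H : ((t n - t j.-1) `^ b - (t n - t j) `^ b) / b / 2 <=
    step t j * (Gamma b * coef_g1 t sigma (alpha 1%N) n j).
  have H1 := ler_wpM2l (ltW m0) H.
  apply: (le_trans (_ : _ <= mu 1%N * (((t n - t j.-1) `^ b - (t n - t j) `^ b) / b / 2))).
    by rewrite le_eqVlt; apply/orP; left; apply/eqP; ring.
  apply: (le_trans H1).
  rewrite [leLHS](_ : _ =
    Gamma b * (step t j * (mu 1%N * coef_g1 t sigma (alpha 1%N) n j)));
    last by ring.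
  rewrite ler_pM2l// ler_pM2l ?step_gt0//.
  exact: coef_g_ge_first.
move: jn; rewrite leq_eqVlt => /predU1P[jn|jn]; last first.
  by apply: (coef_g1_ge_kernel a0 a1 t_incr step_homo n1N (sigma1 n1N)); rewrite j1.
rewrite jn subrr powR0 ?gt_eqF// subr0.
apply: le_trans (coef_g1_diag_ge a0 a1 t_incr step_homo n1N (sigma1 n1N)).
rewrite mulrAC ler_pM2r ?invr_gt0//.
have /andP[s0 s1] := sigma_lt_half n1N.
have tau0 := ltW (step_gt0 n1N).
rewrite powRM//; last by lra.
rewrite mulrC; apply: ler_wpM2r; first exact: powR_ge0.
apply: (@le_trans _ _ (2^-1 `^ b)).
  by apply: ger1_powR; rewrite /b; lra.
by apply: ge0_ler_powR; rewrite ?nnegrE ?(ltW b0)//; lra.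
Qed.

End multiterm.

(** * Graded meshes *)

Section mesh.
Context {R : realType}.

(** Both differences are compared with the derivative r n^(r-1); the case n = 1
is separate because the mean value bounds are on positive arguments. *)
Lemma powR_succ_homo (r : R) (n : nat) : 1 <= r -> (1 <= n)%N ->
  n%:R `^ r - n.-1%:R `^ r <= n.+1%:R `^ r - n%:R `^ r.
Proof.
move=> r1 n1; have n0 : (0 : R) < n%:R by rewrite ltr0n.
have nS : n%:R < n.+1%:R :> R by rewrite ltr_nat.
apply: (@le_trans _ _ (r * (n%:R `^ (r - 1) * 1))); last first.
  apply: powR_chord_ge => //; by rewrite -natr1 addrAC subrr add0r.
rewrite mulr1.
case: n n1 n0 {nS} => // -[|n] _ n0.
  by rewrite /= powR0 ?powR1 ?subr0 ?mulr1// gt_eqF//; lra.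
have := @powR_chord_le _ r n.+1%:R n.+2%:R r1.
rewrite ltr0n ltr_nat !ltnSn => /(_ isT isT) /le_trans; apply.
by rewrite -(natr1 n.+1) [_ + 1 - _]addrAC subrr add0r mulr1.
Qed.

Variables (T r : R) (N : nat).
Hypotheses (T_gt0 : 0 < T) (r_ge1 : 1 <= r) (N_gt0 : (0 < N)%N).

Local Notation t := (graded_mesh T r N).

Lemma graded_meshE n : t n = T / N%:R `^ r * n%:R `^ r.
Proof.
rewrite /graded_mesh powRM ?invr_ge0// -[N%:R^-1]powR_inv1// -powRrM mulN1r powRN.
ring.
Qed.

Let K_gt0 : 0 < T / N%:R `^ r.
Proof. by rewrite divr_gt0// powR_gt0// ltr0n. Qed.

Lemma graded_mesh0 : t 0%N = 0.
Proof.
rewrite graded_meshE powR0 ?mulr0// gt_eqF//; exact: lt_le_trans r_ge1.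
Qed.

Lemma graded_mesh_incr k : (1 <= k)%N -> t k.-1 < t k.
Proof.
move=> k1; rewrite !graded_meshE ltr_pM2l//.
apply: gt0_ltr_powR; rewrite ?nnegrE ?ltr_nat ?prednK//.
exact: lt_le_trans r_ge1.
Qed.

Lemma graded_mesh_step_homo k : (1 <= k)%N -> step t k <= step t k.+1.
Proof.
move=> k1; rewrite /step !graded_meshE -!mulrBr ler_pM2l//.
exact: powR_succ_homo.
Qed.

End mesh.

(** * Summation of the Mittag-Leffler factor *)

Section mittag_sum.
Context {R : realType}.
Variables (al c K : R) (t p : nat -> R) (n : nat).
Hypothesis al0 : 0 < al.
Hypothesis c0 : 0 <= c.
Hypothesis t0 : forall j, (1 <= j <= n)%N -> 0 <= t j.
Hypothesis n1 : (1 <= n)%N.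
Hypothesis sum_p : forall k : nat,
  K * \sum_(1 <= j < n) p j * (t j `^ (k%:R * al) / Gamma (1 + k%:R * al)) <=
  c * (t n `^ (k.+1%:R * al) / Gamma (1 + k.+1%:R * al)).

Lemma mittag_leffler_termE j k : (1 <= j <= n)%N ->
  mittag_leffler_term al (c * t j `^ al) k = c ^+ k * (t j `^ (k%:R * al) / Gamma (1 + k%:R * al)).
Proof.
move=> hj; rewrite /mittag_leffler_term exprMn -(powR_mulrn k (powR_ge0 (t j) al)) -powRrM [al * _]mulrC.
by rewrite mulrA.
Qed.

(** The hypothesis moves the k-th term of the series at the earlier nodes to the
(k+1)-st term at [t n]; the constant term is the 1 that is subtracted. This is
proved for partial sums and passed to the limit. *)
Lemma sum_mittag_leffler_le : K * \sum_(1 <= j < n) p j * mittag_leffler al (c * t j `^ al) <=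
  mittag_leffler al (c * t n `^ al) - 1.
Proof.
have z0 j : 0 <= c * t j `^ al by rewrite mulr_ge0 ?powR_ge0.
have nn : (1 <= n <= n)%N by rewrite n1 leqnn.
have part M : K * \sum_(1 <= j < n) p j * series (mittag_leffler_term al (c * t j `^ al)) M <=
    mittag_leffler al (c * t n `^ al) - 1.
  rewrite lerBrDr; apply: le_trans (mittag_leffler_partial_le M.+1 al0 (z0 n)).
  rewrite /series/= [leRHS]big_nat_recl//=.
  rewrite [X in _ <= X + _](_ : _ = 1); last first.
    by rewrite /mittag_leffler_term expr0 mul0r addr0 Gamma1 divr1.
  rewrite [leLHS]addrC lerD2l.
  have -> : K * \sum_(1 <= j < n) p j * \sum_(0 <= k < M) mittag_leffler_term al (c * t j `^ al) k =
      \sum_(0 <= k < M) c ^+ k * (K *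
        \sum_(1 <= j < n) p j * (t j `^ (k%:R * al) / Gamma (1 + k%:R * al))).
    under eq_bigr do rewrite big_distrr/=.
    rewrite exchange_big/= big_distrr/=; apply: eq_bigr => k _.
    rewrite !big_distrr/=; apply: eq_big_nat => j /andP[j1 jn].
    by rewrite mittag_leffler_termE ?j1 ?(ltnW jn)//; ring.
  apply: ler_sum_nat => k _; rewrite mittag_leffler_termE// exprS.
  by rewrite -mulrA [leRHS]mulrCA ler_wpM2l ?exprn_ge0.
have cv : (fun M => K * \sum_(1 <= j < n)
      p j * series (mittag_leffler_term al (c * t j `^ al)) M) @ \oo -->
    K * \sum_(1 <= j < n) p j * mittag_leffler al (c * t j `^ al).
  apply: cvgM; first exact: cvg_cst.
  apply: cvg_big => [|j _]; first exact: add_continuous.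
  by apply: cvgM; [exact: cvg_cst|exact: cvg_mittag_leffler].
apply: (cvgr_to_le cv); exact: nearW.
Qed.

End mittag_sum.

(** * The Gronwall inequality *)

Theorem theorem3p3 (R : realType) (T r : R) (m N : nat)
  (alpha mu sigma_star : nat -> R)
  (T_gt0 : 0 < T) (r_ge1 : 1 <= r) (m_gt0 : (0 < m)%N) (N_gt0 : (0 < N)%N)
  (mu_gt0 : forall s : nat, (1 <= s <= m)%N -> 0 < mu s)
  (alpha1_lt1 : alpha 1%N < 1)
  (alpha_decr : forall s : nat, (1 <= s < m)%N -> alpha s.+1 < alpha s)
  (alpham_gt0 : 0 < alpha m)
  (sigma_star_root : forall n : nat, (1 <= n <= N)%N ->
     1 - alpha 1%N / 2 <= sigma_star n <= 1 - alpha m / 2 /\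
     shift_fun m alpha mu (graded_mesh T r N) n (sigma_star n) = 0)
  (lambda : nat -> R) (Lambda : R) (xi zeta v : nat -> R) :
  let t := graded_mesh T r N in
  let sigma := fun n : nat => 1 - sigma_star n in
  let g := coef_g m alpha mu t sigma in
  let p := compl g in
  let mu_min := min1 m (fun s => mu s / Gamma (2 - alpha s)) in
  (forall i : nat, (i < N)%N -> 0 <= lambda i) ->
  0 < Lambda ->
  0 < \sum_(0 <= i < N) lambda i <= Lambda ->
  (forall n : nat, (1 <= n)%N -> 0 <= xi n) ->
  (exists M : R, forall n : nat, (1 <= n)%N -> xi n <= M) ->
  (forall n : nat, (1 <= n)%N -> 0 <= zeta n) ->
  (exists M : R, forall n : nat, (1 <= n)%N -> zeta n <= M) ->
  (forall n : nat, 0 <= v n) ->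
  (forall n : nat, (1 <= n <= N)%N ->
     discrete_deriv g (fun j => v j ^+ 2) n <=
       \sum_(1 <= k < n.+1) lambda (n - k)%N * shifted sigma v k ^+ 2
       + xi n * shifted sigma v n + zeta n ^+ 2) ->
  max1 N (step t) <= (11 / (2 * mu_min) * Lambda) `^ (- (alpha 1%N)^-1) ->
  forall n : nat, (1 <= n <= N)%N ->
    v n <=
      2 * mittag_leffler (alpha 1%N)
            (11 / (2 * mu 1%N) * Lambda * t n `^ alpha 1%N)
      * (v 0%N
         + max1 n (fun k => \sum_(1 <= j < k.+1) p k j * (xi j + zeta j))
         + max1 n zeta).
Proof.
move=> t sigma g p mu_min lambda_ge0 Lambda_gt0 /andP[_ sum_lambda] xi_ge0 _
  zeta_ge0 _ v_ge0 deriv_le step_small n n1N.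
have one_m : (1 <= 1 <= m)%N by rewrite m_gt0.
have alpha01 s : (1 <= s <= m)%N -> 0 < alpha s < 1.
  move=> /andP[s1 sm]; apply/andP; split.
    apply: (lt_le_trans alpham_gt0).
    have [d Ed] : exists d, (m - s)%N = d by exists (m - s)%N.
    elim: d s s1 sm Ed => [|d IH] s s1 sm Ed.
      have -> : s = m; last by [].
      by apply/eqP; rewrite eqn_leq sm/= -subn_eq0 Ed.
    have sm' : (s < m)%N by rewrite -subn_gt0 Ed.
    apply: le_trans (IH s.+1 _ sm' _) (ltW (alpha_decr s _)) => //.
      by rewrite subnS Ed.
    by rewrite s1.
  apply: le_lt_trans alpha1_lt1.
  elim: s s1 sm => // -[|s] IH _ sm //.
  apply: le_trans (ltW (alpha_decr s.+1 _)) (IH _ _) => //; exact: ltnW.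
have t_incr k : (1 <= k <= N)%N -> t k.-1 < t k.
  by move=> /andP[k1 _]; exact: graded_mesh_incr.
have step_homo k : (1 <= k < N)%N -> step t k <= step t k.+1.
  by move=> /andP[k1 _]; exact: graded_mesh_step_homo.
have sigma_half k : (1 <= k <= N)%N -> 0 <= sigma k <= 1 / 2.
  move=> /sigma_star_root[/andP[h1 h2] _]; rewrite /sigma.
  by apply/andP; split; lra.
have sigma_root k : (1 <= k <= N)%N -> shift_fun m alpha mu t k (1 - sigma k) = 0.
  by move=> /sigma_star_root[_ h]; rewrite /sigma opprB addrC subrK.
have g_gt0 := coef_g_gt0 m_gt0 mu_gt0 alpha01 t_incr step_homo sigma_half.
have g_homo :=
  coef_g_homo mu_gt0 alpha01 t_incr step_homo sigma_half sigma_root.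
have g_ker := coef_g_kernel m_gt0 mu_gt0 alpha01 t_incr step_homo sigma_half.
have /andP[a0 _] := alpha01 _ one_m.
have m1 := mu_gt0 _ one_m.
have t0 : t 0%N = 0 by exact: graded_mesh0.
(* from here on only the properties of the mesh and of the shifts matter *)
clearbody t sigma.
have c0 : 0 <= mu 1%N / 2 by rewrite divr_ge0// ltW.
have tge0 j : (j <= N)%N -> 0 <= t j by exact: (mesh_ge0 t0 t_incr).
pose c := 11 / (2 * mu 1%N) * Lambda.
have c_ge0 : 0 <= c by rewrite mulr_ge0 ?divr_ge0 ?mulr_ge0// ltW.
pose F k := 2 * mittag_leffler (alpha 1%N) (c * t k `^ alpha 1%N).
apply: (@discrete_gronwall R N g sigma g_gt0 g_homo _ lambda Lambda xi zeta v F lambda_ge0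
  sum_lambda xi_ge0 zeta_ge0 v_ge0 deriv_le _ _ _ _ n n1N).
- move=> k /sigma_half/andP[h1 h2]; rewrite h1/=; lra.
- move=> k k1N; have kk : (1 <= k <= k)%N by case/andP: k1N => -> _; rewrite leqnn.
  have kN : (k <= N)%N by case/andP: k1N.
  have tau0 : 0 < step t k by rewrite subr_gt0 t_incr.
  have b0 : 0 < 1 - alpha 1%N by rewrite subr_gt0.
  have Gb := Gamma_gt0 b0.
  have := g_ker _ _ kk kN.
  have b1 : 1 - alpha 1%N != 0 by rewrite gt_eqF.
  rewrite (subrr (t k)) (powR0 b1) subr0 -/(step t k).
  rewrite powRDgt0// (powRr1 (ltW tau0)) => H.
  have {}H : mu 1%N / Gamma (2 - alpha 1%N) * step t k `^ (- alpha 1%N) / 2 <= g k k.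
    rewrite (Gamma_2sub alpha1_lt1) -(ler_pM2l (mulr_gt0 Gb tau0)).
    rewrite -[leRHS]mulrA; apply: le_trans H.
    move: Gb; set G := Gamma _ => Gb; set x := _ `^ _.
    by rewrite le_eqVlt; apply/orP; left; apply/eqP; field; rewrite !gt_eqF.
  have mm : mu_min <= mu 1%N / Gamma (2 - alpha 1%N).
    exact: (@min1_le R m (fun s => mu s / Gamma (2 - alpha s)) 1%N one_m).
  have mm0 : 0 < mu_min.
    apply: (min1_gt m_gt0) => s sm; have /andP[s0 s1] := alpha01 _ sm.
    apply: divr_gt0; first exact: mu_gt0.
    by apply: Gamma_gt0; lra.
  have C0 : 0 < 11 / (2 * mu_min) * Lambda by rewrite mulr_gt0// divr_gt0// mulr_gt0.
  have tau_le : step t k <= (11 / (2 * mu_min) * Lambda) `^ (- (alpha 1%N)^-1).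
    by apply: le_trans step_small; exact: max1_ge.
  have K : 11 / (2 * mu_min) * Lambda <= step t k `^ (- alpha 1%N).
    have -> : 11 / (2 * mu_min) * Lambda =
        ((11 / (2 * mu_min) * Lambda) `^ (- (alpha 1%N)^-1)) `^ (- alpha 1%N).
      by rewrite -powRrM mulrNN mulVf ?gt_eqF// powRr1// ltW.
    by apply: powRN_nonincr => //; exact: ltW.
  apply: le_trans H.
  have H1 : mu_min * (11 / (2 * mu_min) * Lambda) <=
      mu 1%N / Gamma (2 - alpha 1%N) * step t k `^ (- alpha 1%N).
    by apply: ler_pM => //; exact: ltW.
  have E : mu_min * (11 / (2 * mu_min) * Lambda) = 11 / 2 * Lambda.
    by field; rewrite gt_eqF.
  rewrite E in H1; move: H1; set X := _ / Gamma _ * _ => H1. lra.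
- move=> k k1N; rewrite /F -[leLHS]mulr1 ler_pM2l//.
  by apply: mittag_leffler_ge1 => //; exact: (mulr_ge0 c_ge0 (powR_ge0 _ _)).
- move=> i k /andP[i1 ik] kN; rewrite /F ler_pM2l//.
  apply: mittag_leffler_le => //; first exact: (mulr_ge0 c_ge0 (powR_ge0 _ _)).
  apply: ler_wpM2l => //; apply: ge0_ler_powR; rewrite ?nnegrE ?(ltW a0) ?tge0//.
    exact: leq_trans kN.
  exact: (mesh_le t_incr).
- move=> k k1N; have [k1 kN] := andP k1N.
  have S : 2 * Lambda * \sum_(1 <= j < k)
        compl g k j * mittag_leffler (alpha 1%N) (c * t j `^ alpha 1%N)
      <= mittag_leffler (alpha 1%N) (c * t k `^ alpha 1%N) - 1.
    apply: sum_mittag_leffler_le => // q.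
    have A0 : 0 < q.+1%:R * alpha 1%N by rewrite mulr_gt0.
    have := kernel_sum a0 alpha1_lt1 c0 t0 t_incr step_homo g_gt0 g_homo g_ker A0 k1N.
    rewrite (_ : q.+1%:R * alpha 1%N - alpha 1%N = q%:R * alpha 1%N); last first.
      by rewrite -natr1; ring.
    rewrite (_ : q.+1%:R * alpha 1%N + (1 - alpha 1%N) = 1 + q%:R * alpha 1%N); last first.
      by rewrite -natr1; ring.
    rewrite [q.+1%:R * alpha 1%N + 1]addrC.
    set S := \sum_(1 <= j < k) _; set X := t k `^ _ / _ => H.
    have X0 : 0 <= X.
      rewrite /X divr_ge0 ?powR_ge0// ltW// Gamma_gt0//; lra.
    have -> : 2 * Lambda * S = 4 * Lambda / mu 1%N * (mu 1%N / 2 * S).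
      by field; rewrite gt_eqF.
    (* 4 <= 11/2, so the constant of the theorem leaves some room *)
    apply: (@le_trans _ _ (4 * Lambda / mu 1%N * X)).
      by apply: ler_wpM2l => //; rewrite divr_ge0 ?mulr_ge0// ltW.
    apply: ler_wpM2r => //.
    have -> : c = 11 / 2 * (Lambda / mu 1%N) by rewrite /c; field; rewrite gt_eqF.
    have L0 : 0 <= Lambda / mu 1%N by rewrite divr_ge0// ltW.
    rewrite -mulrA; lra.
  rewrite /F; have -> : \sum_(1 <= j < k)
      compl g k j * (2 * mittag_leffler (alpha 1%N) (c * t j `^ alpha 1%N)) =
     2 * \sum_(1 <= j < k) compl g k j * mittag_leffler (alpha 1%N) (c * t j `^ alpha 1%N).
    by rewrite big_distrr/=; apply: eq_bigr => j _; ring.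
  move: S; set S := \sum_(1 <= j < k) _; lra.
Qed.
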